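(* Let $(\mathbf x,B)$ be a seed of $\mathcal F$, and let $\mathbf y=(y_1,\dots,y_m)$ and $\mathbf z=(z_1,\dots,z_m)$ be disjoint clusters of $\mathcal A(\mathbf x,B)$. Suppose $U$ is a $K$-subalgebra of $\mathcal A(\mathbf x,B)$ which is a factorial ring and contains $$\{y_1,\dots,y_n,z_1,\dots,z_n,x_{n+1}^{\pm1},\dots,x_p^{\pm1},x_{p+1},\dots,x_m\}.$$ Then $U=\mathcal A(\mathbf x,B)=U(\mathbf y,\mathbf z)$. In particular $\mathcal A(\mathbf x,B)$ is factorial and all cluster variables of $\mathcal A(\mathbf x,B)$ are prime elements.
   Context: Let $K$ be a field of characteristic $0$ or $K=\mathbb Z$. Fix integers $m\ge p\ge n\ge 1$ with $m>1$, and let $\mathcal F=K(X_1,\dots,X_m)$. For $B=(b_{ij})\in M_{m,n}(\mathbb Z)$ the principal part $B^\circ$ is the $n\times n$ matrix formed by the first $n$ rows. $B$ is connected if the graph with vertices $1,\dots,m$ and an edge between $i$ and $j$ whenever $b_{ij}\neq 0$ or $b_{ji}\ne 0$ is connected. A square integer matrix $A$ is skew-symmetrizable if $DA$ is skew-symmetric for some diagonal integer matrix $D$ with positive diagonal entries. A seed of $\mathcal F$ is a pair $(\mathbf x,B)$ where $B\in M_{m,n}(\mathbb Z)$ is connected with $B^\circ$ skew-symmetrizable, and $\mathbf x=(x_1,\dots,x_m)$ is an $m$-tuple of elements of $\mathcal F$ algebraically independent over $K$. For $1\le k\le n$ the mutation $\mu_k(\mathbf x,B)=(\mathbf x',B')$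 is given by $b'_{ij}=-b_{ij}$ if $i=k$ or $j=k$, and $b'_{ij}=b_{ij}+\frac{|b_{ik}|b_{kj}+b_{ik}|b_{kj}|}{2}$ otherwise; $x'_s=x_s$ for $s\neq k$ and $x'_k=x_k^{-1}\big(\prod_{b_{ik}>0}x_i^{b_{ik}}+\prod_{b_{ik}<0}x_i^{-b_{ik}}\big)$. Two seeds are mutation equivalent if one is obtained from the other by a finite sequence of mutations $\mu_{i_1},\dots,\mu_{i_t}$ with $1\le i_j\le n$. The cluster algebra $\mathcal A(\mathbf x,B)$ is the $K$-subalgebra of $\mathcal F$ generated by $x_{n+1}^{\pm1},\dots,x_p^{\pm1},x_{p+1},\dots,x_m$ together with all elements $y_1,\dots,y_n$ for all seeds $(\mathbf y,C)$ mutation equivalent to $(\mathbf x,B)$; these $y_i$ ($1\le i\le n$) are the cluster variables, and for such a seed $\mathbf y$ is called a cluster (note $y_i=x_i$ for $n<i\le m$). Two clusters $\mathbf y,\mathbf z$ are disjoint if $\{y_1,\dots,y_n\}\cap\{z_1,\dots,z_n\}=\varnothing$. For a cluster $\mathbf y$ let $\mathscr L_{\mathbf y}=K[y_1^{\pm1},\dots,y_p^{\pm1},y_{p+1},\dots,y_m]\subseteq\mathcal F$, and set $U(\mathbf y,\mathbf z)=\mathscr L_{\mathbf y}\cap\mathscr L_{\mathbf z}$. *)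

(* Defs.v *)
From HB Require Import structures.
From mathcomp Require Import all_boot all_order all_algebra all_fingroup.
From mathcomp Require Import fraction.
From mathcomp Require Import mpoly.

Set Implicit Arguments.
Unset Strict Implicit.
Unset Printing Implicit Defensive.

Import Order.TTheory GRing.Theory Num.Theory.
Local Open Scope ring_scope.

Definition F (K : idomainType) (m : nat) : fieldType := {fraction {mpoly K[m]}}.

Section ClusterDefs.
Context (K : idomainType) (m n : nat).

Local Notation FF := (F K m).

Definition Kemb (c : K) : FF := tofrac (c%:MP : {mpoly K[m]}).

(* entries of B indexed by (0-based) natural numbers; 0 outside the range *)
Definition Bnat (B : 'M[int]_(m, n)) (i j : nat) : int :=
  match @insub nat (fun k => k < m)%N 'I_m i, @insub nat (fun k => k < n)%N 'I_n j with
  | Some i', Some j' => B i' j'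
  | _, _ => 0
  end.

Definition principal (B : 'M[int]_(m, n)) : 'M[int]_n :=
  \matrix_(i < n, j < n) Bnat B i j.

Definition skew_symmetrizable (A : 'M[int]_n) : Prop :=
  exists d : 'I_n -> int, (forall i, 0 < d i) /\
    (forall i j, d i * A i j = - (d j * A j i)).

Definition connectedB (B : 'M[int]_(m, n)) : Prop :=
  forall i j : 'I_m,
    connect (fun a b : 'I_m => (Bnat B a b != 0) || (Bnat B b a != 0)) i j.

Definition alg_indep (x : 'I_m -> FF) : Prop :=
  forall q : {mpoly K[m]}, mmap Kemb x q = 0 -> q = 0.

Definition is_seed (x : 'I_m -> FF) (B : 'M[int]_(m, n)) : Prop :=
  connectedB B /\ skew_symmetrizable (principal B) /\ alg_indep x.

Definition mutB (k : 'I_n) (B : 'M[int]_(m, n)) : 'M[int]_(m, n) :=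
  \matrix_(i < m, j < n)
    if (val i == val k) || (val j == val k) then - B i j
    else B i j + ((`|Bnat B i k| * Bnat B k j + Bnat B i k * `|Bnat B k j|) %/ 2)%Z.

Definition mutx (k : 'I_n) (x : 'I_m -> FF) (B : 'M[int]_(m, n)) : 'I_m -> FF :=
  fun s => if val s == val k then
             (x s)^-1 * (\prod_(i < m | 0 < B i k) x i ^+ `|B i k|%N
                         + \prod_(i < m | B i k < 0) x i ^+ `|B i k|%N)
           else x s.

Definition mutate (k : 'I_n) (S : ('I_m -> FF) * 'M[int]_(m, n)) :=
  (mutx k S.1 S.2, mutB k S.2).

Definition mut_equiv (S T : ('I_m -> FF) * 'M[int]_(m, n)) : Prop :=
  exists ks : seq 'I_n, foldl (fun S k => mutate k S) S ks = T.

Inductive gen (S : FF -> Prop) : FF -> Prop :=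
  | gen_base f : S f -> gen S f
  | gen_K c : gen S (Kemb c)
  | gen_add a b : gen S a -> gen S b -> gen S (a + b)
  | gen_opp a : gen S a -> gen S (- a)
  | gen_mul a b : gen S a -> gen S b -> gen S (a * b).

Definition Ksubalg (S : FF -> Prop) : Prop :=
  (forall c, S (Kemb c)) /\ (forall a b, S a -> S b -> S (a + b)) /\
  (forall a, S a -> S (- a)) /\ (forall a b, S a -> S b -> S (a * b)).

Definition is_cluster (x : 'I_m -> FF) (B : 'M[int]_(m, n)) (y : 'I_m -> FF) : Prop :=
  exists C : 'M[int]_(m, n), mut_equiv (x, B) (y, C).

Definition is_cluster_var (x : 'I_m -> FF) (B : 'M[int]_(m, n)) (f : FF) : Prop :=
  exists (y : 'I_m -> FF), is_cluster x B y /\ exists i : 'I_m, (i < n)%N /\ f = y i.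

Definition disjoint_clusters (y z : 'I_m -> FF) : Prop :=
  forall i j : 'I_m, (i < n)%N -> (j < n)%N -> y i <> z j.

(* the cluster algebra A(x,B) (0-based indices: x_{n+1..p} are i with n <= i < p) *)
Definition clalg (p : nat) (x : 'I_m -> FF) (B : 'M[int]_(m, n)) : FF -> Prop :=
  gen (fun f => (exists i : 'I_m, (n <= i < p)%N /\ (f = x i \/ f = (x i)^-1))
             \/ (exists i : 'I_m, (p <= i)%N /\ f = x i)
             \/ is_cluster_var x B f).

Definition laurent (p : nat) (y : 'I_m -> FF) : FF -> Prop :=
  gen (fun f => exists i : 'I_m,
        ((i < p)%N /\ (f = y i \/ f = (y i)^-1)) \/ ((p <= i)%N /\ f = y i)).

Definition Uyz (p : nat) (y z : 'I_m -> FF) : FF -> Prop :=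
  fun f => laurent p y f /\ laurent p z f.

Definition is_subring (S : FF -> Prop) : Prop :=
  S 0 /\ S 1 /\ (forall a b, S a -> S b -> S (a + b)) /\
  (forall a, S a -> S (- a)) /\ (forall a b, S a -> S b -> S (a * b)).

Definition unitIn (S : FF -> Prop) (a : FF) : Prop :=
  S a /\ exists b, S b /\ a * b = 1.

Definition dvdIn (S : FF -> Prop) (a b : FF) : Prop :=
  exists c, S c /\ b = a * c.

Definition assocIn (S : FF -> Prop) (a b : FF) : Prop :=
  exists u, unitIn S u /\ a = u * b.

Definition irredIn (S : FF -> Prop) (a : FF) : Prop :=
  S a /\ a <> 0 /\ ~ unitIn S a /\
  (forall b c, S b -> S c -> a = b * c -> unitIn S b \/ unitIn S c).

Definition primeIn (S : FF -> Prop) (a : FF) : Prop :=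
  S a /\ a <> 0 /\ ~ unitIn S a /\
  (forall b c, S b -> S c -> dvdIn S a (b * c) -> dvdIn S a b \/ dvdIn S a c).

Definition is_factorial (S : FF -> Prop) : Prop :=
  is_subring S /\
  (forall a, S a -> a <> 0 -> ~ unitIn S a ->
     exists s : seq FF, (forall q, q \in s -> irredIn S q) /\ a = \prod_(q <- s) q) /\
  (forall s t : seq FF, (forall q, q \in s -> irredIn S q) ->
     (forall q, q \in t -> irredIn S q) -> \prod_(q <- s) q = \prod_(q <- t) q ->
     exists t' : seq FF, perm_eq t t' /\ size s = size t' /\
       forall i, (i < size s)%N -> assocIn S (nth 0 s i) (nth 0 t' i)).

End ClusterDefs.

(* Main.v *)
Require Import Defs.
From HB Require Import structures.
From mathcomp Require Import all_boot all_order all_algebra all_fingroup.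
From mathcomp Require Import fraction.
From mathcomp Require Import mpoly zify ring.
From Stdlib Require Import FunctionalExtensionality PropExtensionality Classical_Prop.
Set Implicit Arguments.
Unset Strict Implicit.
Unset Printing Implicit Defensive.
Import Order.TTheory GRing.Theory Num.Theory.
Local Open Scope ring_scope.

(* The proof rests on the Laurent phenomenon. For a path starting with mutations at i and j,
   one adds a single frozen variable t placed so that it enters the exchange relation of x_j'
   in the same monomial as x_i'. Over the Laurent ring L of the initial cluster, x_i' is then
   constant in t, while x_j' and the next x_i'' are polynomials in t whose constant terms are
   units of L; hence the denominators in x_i' and in x_j' x_i'' given by the induction
   hypothesis are coprime up to t, and setting t = 1 gives the claim. Exchange relations have
   positive values where one frozen variable is 0 and all others are 1, so noninvertible
   frozen variables never occur in denominators.

   Comparing the Laurent expansions in a cluster and in its neighbours shows that the units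
   of the cluster algebra A are unit scalars times Laurent monomials in x_{n+1},...,x_p, that
   cluster variables are irreducible, and (by integrality and positivity) that associated
   cluster variables are equal. In the factorial ring U the variables y_i are therefore
   primes not dividing any z_j, so an element whose denominators are a monomial in the y_i
   and also a monomial in the z_j lies in U: thus U(y,z) is contained in U, which is contained
   in A, which is contained in U(y,z). *)

(** * Integer identities behind matrix mutation *)

Section IntegerMutation.
Implicit Types a b : int.

Definition pos a : int := if 0 < a then a else 0.

(** Since |a| = 2 [pos (- e * a)] + e a and |b| = 2 [pos (e * b)] - e b, the two terms e a b cancel
    and the halving is exact. The free sign [e] is adapted to each later use. *)
Lemma half_abs_mul a b e : (e == 1) || (e == -1) ->
  ((`|a| * b + a * `|b|) %/ 2)%Z = pos (- e * a) * b + a * pos (e * b).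
Proof.
move=> he.
have h2 c : ((c + c) %/ 2)%Z = c.
  by rewrite -{1}[c]mulr1 -{2}[c]mulr1 -mulrDr mulzK.
have [ha|ha] := lerP 0 a; have [hb|hb] := lerP 0 b;
  rewrite ?(ger0_norm ha) ?(ltr0_norm ha) ?(ger0_norm hb) ?(ltr0_norm hb);
  (case/orP: he => /eqP ->; rewrite /pos).
- rewrite h2; have -> : (0 < -1 * a) = false by lia.
  by have [h|h] := ltrP 0 (1 * b); [ring | have -> : b = 0 by lia]; ring.
- rewrite h2; have -> : (0 < -1 * b) = false by lia.
  by have [h|h] := ltrP 0 (- -1 * a); [ring | have -> : a = 0 by lia]; ring.
all: try (have -> : a * b + a * - b = 0 by ring).
all: try (have -> : - a * b + a * b = 0 by ring).
all: try (have -> : - a * b + a * - b = - (a * b) + - (a * b) by ring).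
all: rewrite ?div0z ?h2.
all: case: ifP => h1; case: ifP => h3; try lia; try ring.
all: (have ab0 : a = 0 \/ b = 0 by lia); case: ab0 => ->; ring.
Qed.

End IntegerMutation.

(** * Seeds and mutations over a finite index type and a field *)

Section GenericSeeds.
Variables (E : fieldType) (T : finType).
Implicit Types (mut : pred T) (x : T -> E) (B : T -> T -> int) (k : T) (e : T -> int).

Definition gmutB k B : T -> T -> int := fun i j =>
  if (i == k) || (j == k) then - B i j
  else B i j + ((`|B i k| * B k j + B i k * `|B k j|) %/ 2)%Z.

Definition exch x (b : T -> int) : E :=
  \prod_(i | 0 < b i) x i ^+ `|b i|%N + \prod_(i | b i < 0) x i ^+ `|b i|%N.

Definition gmutx k x B : T -> E := fun s =>
  if s == k then (x s)^-1 * exch x (B^~ k) else x s.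

Definition gseed : Type := ((T -> E) * (T -> T -> int))%type.

Definition gmut (S : gseed) k : gseed := (gmutx k S.1 S.2, gmutB k S.2).

Definition gpath (S : gseed) (ks : seq T) : gseed := foldl gmut S ks.

Definition skewable (mut : pred T) B := exists d : T -> int,
  (forall i, mut i -> 0 < d i) /\
  (forall i j, mut i -> mut j -> d i * B i j = - (d j * B j i)).

(** The inverse of 0 is 0 in these fields, so nonvanishing is what makes every exchange relation a
    true division and mutation an involution. *)
Definition nonvanishing (mut : pred T) (S : gseed) :=
  forall ks, all mut ks -> forall r, (gpath S ks).1 r != 0.

Definition lmon x e : E := \prod_i x i ^ e i.

Lemma lmonD x e f : (forall i, x i != 0) ->
  lmon x (fun i => e i + f i) = lmon x e * lmon x f.
Proof.
by move=> hx; rewrite /lmon -big_split; apply: eq_bigr => i _; rewrite expfzDr.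
Qed.

Lemma lmon_neq0 x e : (forall i, x i != 0) -> lmon x e != 0.
Proof. by move=> hx; apply/prodf_neq0 => i _; rewrite expfz_neq0. Qed.

Lemma lmonN x e : lmon x (fun i => - e i) = (lmon x e)^-1.
Proof. by rewrite /lmon -prodfV; apply: eq_bigr => i _; rewrite invr_expz. Qed.

Lemma lmonX x e (a : nat) : lmon x (fun i => e i * a%:Z) = lmon x e ^+ a.
Proof. by rewrite /lmon -prodrXl; apply: eq_bigr => i _; rewrite -exprz_exp. Qed.

Lemma lmonD1 k x e : lmon x e = x k ^ e k * \prod_(i | i != k) x i ^ e i.
Proof. by rewrite /lmon (bigD1 k). Qed.

Lemma eq_lmon x e f : e =1 f -> lmon x e = lmon x f.
Proof. by move=> h; apply: eq_bigr => i _; rewrite h. Qed.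

Lemma pos_monomial x (b : T -> int) :
  \prod_(i | 0 < b i) x i ^+ `|b i|%N = lmon x (fun i => pos (b i)).
Proof.
rewrite /lmon big_mkcond; apply: eq_bigr => i _; rewrite /pos.
by case: ifP => h; rewrite ?expr0z //; rewrite -{2}(gtz0_abs h) -exprnP.
Qed.

Lemma neg_monomial x (b : T -> int) :
  \prod_(i | b i < 0) x i ^+ `|b i|%N = lmon x (fun i => pos (- b i)).
Proof.
rewrite /lmon big_mkcond; apply: eq_bigr => i _; rewrite /pos oppr_gt0.
by case: ifP => h; rewrite ?expr0z //; rewrite -(ltz0_abs h) -exprnP.
Qed.

Lemma posB (a : int) : pos a = a + pos (- a).
Proof. by rewrite /pos; case: ifP => h; case: ifP => h'; lia. Qed.

(* Tropical sign form of the exchange relation: the sign [s] may be chosen freely. *)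
Lemma exch_lmon x (b : T -> int) (s : int) :
  (s == 1) || (s == -1) -> (forall i, x i != 0) ->
  exch x b = lmon x (fun i => pos (- s * b i)) * (1 + lmon x (fun i => s * b i)).
Proof.
move=> hs hx; rewrite /exch pos_monomial neg_monomial mulrDr mulr1 -lmonD //.
case/orP: hs => /eqP ->.
  rewrite addrC; congr (_ + _); apply: eq_lmon => i; first by rewrite mulN1r.
  by rewrite mul1r mulN1r posB addrC.
congr (_ + _); apply: eq_lmon => i; rewrite opprK mul1r //.
by rewrite mulN1r posB opprK addrC.
Qed.

Lemma gmutB_sign k B i j (s : int) : (s == 1) || (s == -1) -> i != k -> j != k ->
  gmutB k B i j = B i j + pos (- s * B i k) * B k j + B i k * pos (s * B k j).
Proof.
move=> hs /negbTE hi /negbTE hj; rewrite /gmutB hi hj /= -addrA; congr (_ + _).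
exact: half_abs_mul.
Qed.

Lemma gmutBl k B j : gmutB k B k j = - B k j.
Proof. by rewrite /gmutB eqxx. Qed.

Lemma gmutBr k B i : gmutB k B i k = - B i k.
Proof. by rewrite /gmutB eqxx orbT. Qed.

Lemma skewable_diag mut B i : skewable mut B -> mut i -> B i i = 0.
Proof. by case=> d [dp h] mi; have := h i i mi mi; have := dp i mi; nia. Qed.

(** The same symmetriser [d] works: it carries the positive part of an entry to the negative part of
    the transposed entry, so the two correction terms are interchanged up to sign. *)
Lemma skewable_mut mut B k : mut k -> skewable mut B -> skewable mut (gmutB k B).
Proof.
move=> mk [d [dp h]]; exists d; split=> // i j mi mj.
have [->|nik] := eqVneq i k; first by rewrite gmutBl gmutBr !mulrN h.
have [->|njk] := eqVneq j k; first by rewrite gmutBl gmutBr !mulrN h.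
rewrite (@gmutB_sign k B i j 1) // (@gmutB_sign k B j i 1) //.
rewrite !mul1r !mulN1r.
have [hij hik hjk] : [/\ d i * B i j = - (d j * B j i),
    d i * B i k = - (d k * B k i) & d k * B k j = - (d j * B j k)].
  by split; apply: h.
have [di dj dk] : [/\ 0 < d i, 0 < d j & 0 < d k] by split; apply: dp.
have e1 : d i * pos (- B i k) = d k * pos (B k i).
  rewrite /pos; case: ifP => h1; case: ifP => h2; nia.
have e2 : d k * pos (B k j) = d j * pos (- B j k).
  rewrite /pos; case: ifP => h1; case: ifP => h2; nia.
rewrite 2!mulrDr !mulrA hij hik e1.
have -> : - (d k * B k i) * pos (B k j) = - (B k i * (d j * pos (- B j k))).
  by rewrite -e2; ring.
have -> : d k * pos (B k i) * B k j = pos (B k i) * (d k * B k j) by ring.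
rewrite hjk; ring.
Qed.

(** The outer mutation is expanded with sign 1 and the inner one with sign -1; as row and column [k]
    have changed sign in between, the corrections cancel term by term. *)
Lemma gmutBK mut B k : mut k -> skewable mut B -> gmutB k (gmutB k B) = B.
Proof.
move=> mk hB; apply: functional_extensionality => i.
apply: functional_extensionality => j.
have [->|nik] := eqVneq i k; first by rewrite !gmutBl opprK.
have [->|njk] := eqVneq j k; first by rewrite !gmutBr opprK.
rewrite (@gmutB_sign k _ i j 1) // (@gmutB_sign k _ i j (-1)) //.
by rewrite gmutBl gmutBr !opprK !mul1r !mulN1r !opprK; ring.
Qed.

Lemma exch_eq x x' b : (forall i, b i != 0 -> x i = x' i) -> exch x b = exch x' b.
Proof.
move=> h; congr (_ + _); apply: eq_bigr => i hi; rewrite h //;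
 [exact: lt0r_neq0 | exact: ltr0_neq0].
Qed.

Lemma exchN x b : exch x (fun i => - b i) = exch x b.
Proof.
rewrite /exch addrC; congr (_ + _).
  by apply: eq_big => i; rewrite ?oppr_lt0 ?abszN.
by apply: eq_big => i; rewrite ?oppr_gt0 ?abszN.
Qed.

(** As [B k k = 0], the exchange polynomial does not involve x_k, and negating column [k] merely
    swaps its two monomials; both mutations therefore use the same numerator. *)
Lemma gmutxK mut x B k : mut k -> skewable mut B ->
  gmutx k x B k != 0 -> gmutx k (gmutx k x B) (gmutB k B) = x.
Proof.
move=> mk hB hx; apply: functional_extensionality => s.
rewrite {1}/gmutx; case: eqP => [->|/eqP /negbTE hs]; last by rewrite /gmutx hs.
have -> : exch (gmutx k x B) (fun i => gmutB k B i k) = exch x (B^~ k).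
  have -> : (fun i => gmutB k B i k) = (fun i => - B i k).
    by apply: functional_extensionality => i; rewrite gmutBr.
  rewrite -(exchN x (B^~ k)).
  apply: exch_eq => i; rewrite oppr_eq0 /gmutx; have [->|//] := eqVneq i k.
  by rewrite (skewable_diag hB mk) eqxx.
move: hx; rewrite /gmutx eqxx mulf_eq0 negb_or => /andP [h1 h2].
by rewrite invfM invrK mulrVK // unitfE.
Qed.

Lemma gmutK mut S k : mut k -> skewable mut S.2 -> nonvanishing mut S ->
  gmut (gmut S k) k = S.
Proof.
case: S => x B mk hB hx; rewrite /gmut /=; congr (_, _).
  apply: (@gmutxK mut) => //; apply: (hx [:: k]); by rewrite /= mk.
exact: gmutBK hB.
Qed.

Lemma nonvanishing_gpath mut S ks : all mut ks ->
  nonvanishing mut S -> nonvanishing mut (gpath S ks).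
Proof.
move=> hk h js hj r; rewrite /gpath -foldl_cat; apply: h.
by rewrite all_cat hk.
Qed.

Lemma skewable_gpath mut S ks : all mut ks ->
  skewable mut S.2 -> skewable mut (gpath S ks).2.
Proof.
elim: ks S => //= k ks IH S /andP [mk mks] h.
by apply: IH => //; apply: skewable_mut.
Qed.

Lemma gpath_rev mut S ks : all mut ks -> skewable mut S.2 -> nonvanishing mut S ->
  gpath (gpath S ks) (rev ks) = S.
Proof.
elim/last_ind: ks => // ks k IH; rewrite all_rcons => /andP [mk mks] h h'.
rewrite rev_rcons /gpath foldl_rcons /= (@gmutK mut) //.
- exact: IH.
- exact: skewable_gpath.
- exact: nonvanishing_gpath.
Qed.

End GenericSeeds.

(** * Subrings of a field as predicates *)

Section SubringPredicates.
Variables (E : fieldType) (L : E -> Prop).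

Record subring_pred : Prop := SubringPred {
  sr1 : L 1;
  srD : forall a b, L a -> L b -> L (a + b);
  srN : forall a, L a -> L (- a);
  srM : forall a b, L a -> L b -> L (a * b) }.

(** For nonzero [a] this means a unit of [L]; zero satisfies it too when it lies in [L], so
    nonvanishing is recorded separately. *)
Definition bi_in (a : E) : Prop := L a /\ L a^-1.

Hypothesis hL : subring_pred.

Lemma sr0 : L 0.
Proof. by rewrite -(subrr 1); apply: srD => //; [|apply: srN => //]; apply: sr1. Qed.

Lemma srX a (k : nat) : L a -> L (a ^+ k).
Proof.
by move=> ha; elim: k => [|k IH]; [rewrite expr0; exact: sr1 | rewrite exprS; exact: srM].
Qed.

Lemma bi_inV a : bi_in a -> bi_in a^-1.
Proof. by case=> h1 h2; split=> //; rewrite invrK. Qed.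

Lemma bi_inM a b : bi_in a -> bi_in b -> bi_in (a * b).
Proof. by case=> h1 h2 [h3 h4]; split; rewrite ?invfM; apply: srM. Qed.

Lemma bi_inX a k : bi_in a -> bi_in (a ^+ k).
Proof. by case=> h1 h2; split; rewrite -?exprVn; apply: srX. Qed.

Lemma bi_in_expz a (z : int) : bi_in a -> L (a ^ z).
Proof. by case: z => k [h1 h2]; rewrite ?NegzE -?exprz_inv; apply: srX. Qed.

Lemma sr_prod (I : finType) (P : pred I) (f : I -> E) :
  (forall i, P i -> L (f i)) -> L (\prod_(i | P i) f i).
Proof. by move=> h; apply: (big_ind L) => //; [exact: sr1 | exact: srM]. Qed.

Lemma sr_lmon (T : finType) (x : T -> E) e :
  (forall i, e i = 0 \/ bi_in (x i) \/ L (x i) /\ 0 <= e i) -> L (lmon x e).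
Proof.
move=> h; apply: sr_prod => i _.
case: (h i) => [->|[h1|[h1 h2]]]; first by rewrite expr0z; exact: sr1.
  exact: bi_in_expz.
by rewrite -(gez0_abs h2); apply: srX.
Qed.

Lemma bi_in_lmon (T : finType) (x : T -> E) e :
  (forall i, e i = 0 \/ bi_in (x i)) -> bi_in (lmon x e).
Proof.
move=> h; split; rewrite -?lmonN; apply: sr_lmon => i;
  by case: (h i) => [->|]; rewrite ?oppr0; auto.
Qed.

Lemma sr_nat (k : nat) : L k%:R.
Proof. by elim: k => [|k IH]; [exact: sr0 | rewrite -addn1 natrD; apply: srD => //; exact: sr1]. Qed.

Lemma sr_int (z : int) : L z%:~R.
Proof.
case: z => k; first exact: sr_nat.
by rewrite NegzE mulrNz; apply: srN => //; apply: sr_nat.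
Qed.

End SubringPredicates.

(** * Three exchanges at i, j, i in the presence of a frozen variable tau *)

Section ExchangeWithTracker.
Variables (E : fieldType) (T : finType) (x : T -> E) (B : T -> T -> int).
Variables (mut : pred T) (i j tau : T) (s : int) (L Lt : E -> Prop).
Hypotheses (hL : subring_pred L) (hLt : subring_pred Lt).
Hypotheses (LLt : forall a, L a -> Lt a) (Lt_tau : Lt (x tau)).
Hypotheses (hx : forall l, l != tau -> bi_in L (x l)).
Hypotheses (nv : nonvanishing mut (x, B)) (sk : skewable mut B).
Hypotheses (mi : mut i) (mj : mut j) (nij : i != j).
Hypotheses (nti : tau != i) (ntj : tau != j).
Hypotheses (Bti : B tau i = 0) (Btj : B tau j = s).

Let x1 := gmutx i x B.
Let B1 := gmutB i B.
Let x2 := gmutx j x1 B1.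
Let B2 := gmutB j B1.

Hypotheses (hs : (s == 1) || (s == -1)) (sij : 0 <= s * B1 i j).

Let c := x1 i.

Let sji : s * B1 j i <= 0.
Proof.
have [d [dp h]] := skewable_mut mi sk.
have := h i j mi mj; have := dp i mi; have := dp j mj.
move: sij; rewrite -/B1; case/orP: hs => /eqP ->; nia.
Qed.

Let Bji0 : B1 i j = 0 -> B1 j i = 0.
Proof.
have [d [dp h]] := skewable_mut mi sk.
by have := h i j mi mj; have := dp j mj; rewrite -/B1; nia.
Qed.

Let nx l : x l != 0. Proof. exact: (nv (ks := [::])). Qed.
Let nx1 l : x1 l != 0.
Proof. by apply: (nv (ks := [:: i])); rewrite /= mi. Qed.
Let nx2 l : x2 l != 0.
Proof. by apply: (nv (ks := [:: i; j])); rewrite /= mi mj. Qed.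

Let x1E l : l != i -> x1 l = x l.
Proof. by rewrite /x1 /gmutx => /negbTE ->. Qed.
Let x2E l : l != j -> x2 l = x1 l.
Proof. by rewrite /x2 /gmutx => /negbTE ->. Qed.

Let nji : j != i. Proof. by rewrite eq_sym. Qed.
Let nit : i != tau. Proof. by rewrite eq_sym. Qed.
Let njt : j != tau. Proof. by rewrite eq_sym. Qed.
Let B1ii : B1 i i = 0.
Proof. by rewrite /B1 gmutBl (skewable_diag sk mi) oppr0. Qed.
Let B1jj : B1 j j = 0.
Proof. exact: skewable_diag (skewable_mut mi sk) mj. Qed.
Let B1ti : B1 tau i = 0. Proof. by rewrite /B1 gmutBr Bti oppr0. Qed.
Let B1tj : B1 tau j = s.
Proof.
by rewrite /B1 (@gmutB_sign _ i B tau j 1) // Bti Btj mulr0 {1}/pos ltxx !mul0r !addr0.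
Qed.
Let ss1 : s * s = 1. Proof. by case/orP: hs => /eqP ->. Qed.

(** Since [B tau i = 0], the first exchange relation avoids tau, and all other initial variables are
    units of [L]. *)
Lemma tracker_first : L c.
Proof.
rewrite /c /x1 /gmutx eqxx (@exch_lmon _ _ _ _ 1) //.
have h l : B l i = 0 \/ bi_in L (x l).
  by have [->|h] := eqVneq l tau; [left | right; apply: hx].
apply: srM => //; first by case: (hx nit).
apply: srM => //; last apply: srD => //.
- by apply: sr_lmon => // l; case: (h l) => [->|]; [left|right;left].
- exact: sr1.
- by apply: sr_lmon => // l; case: (h l) => [->|]; [left; rewrite mulr0|right;left].
Qed.

Let bx1 l : l != tau -> l != i -> bi_in L (x1 l).
Proof. by move=> h1 h2; rewrite x1E //; apply: hx. Qed.

(** [A] is the tau-free monomial of the exchange relation at [j], divided by x_j. By the choice of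
    [s] it does not involve the new variable [c] either, so it is a unit of [L]. *)
Let a1 := fun l => pos (- s * B1 l j).
Let A := (x j)^-1 * lmon x1 a1.

Let a1t : a1 tau = 0. Proof. by rewrite /a1 B1tj mulNr ss1. Qed.
Let a1i : a1 i = 0.
Proof. by rewrite /a1 mulNr /pos oppr_gt0 ltNge sij. Qed.

Let biA : bi_in L A.
Proof.
apply: bi_inM => //; first by apply: bi_inV => //; apply: hx.
apply: bi_in_lmon => // l.
have [->|h1] := eqVneq l tau; first by left.
have [->|h2] := eqVneq l i; first by left.
by right; apply: bx1.
Qed.

Let off k (f : T -> int) := fun l => if l == k then 0 else f l.

Let lmon_off (y : T -> E) k f : lmon y f = y k ^ f k * lmon y (off k f).
Proof.
rewrite [in LHS](lmonD1 k) (lmonD1 k y (off k f)) /off eqxx expr0z mul1r.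
by congr (_ * _); apply: eq_bigr => l /negbTE ->.
Qed.

Let D := A * lmon x1 (off tau (fun l => s * B1 l j)).

Let LD : L D.
Proof.
apply: srM => //; first by case: biA.
apply: sr_lmon => // l; rewrite /off.
have [->|h1] := eqVneq l tau; first by left.
right; have [->|h2] := eqVneq l i; first by right; split=> //; exact: tracker_first.
by left; apply: bx1.
Qed.

(** If [i] and [j] are linked, the monomial carrying tau also carries [c]. This factor later cancels
    the division by [c] in the third exchange. *)
Let Dc : B1 i j != 0 -> exists2 D', L D' & D = c * D'.
Proof.
move=> hn; exists (A * lmon x1 (fun l => off tau (fun l => s * B1 l j) l - (l == i)%:Z)).
  apply: srM => //; first by case: biA.
  apply: sr_lmon => // l; rewrite /off.
  have [->|h1] := eqVneq l tau; first by left; rewrite (negbTE nti).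
  right; have [->|h2] := eqVneq l i; last by left; apply: bx1.
  right; split; first exact: tracker_first.
  by move: sij hn; case/orP: hs => /eqP ->; lia.
rewrite lmonD // (_ : lmon x1 (fun l => - (l == i)%:Z) = c^-1); last first.
  by rewrite (lmonD1 i) eqxx big1 ?mulr1 // => l /negbTE ->; rewrite oppr0 expr0z.
by rewrite mulrCA [c * _]mulrCA mulfV ?mulr1 // nx1.
Qed.

Let x2j : x2 j = A + D * x tau.
Proof.
rewrite /x2 {1}/gmutx eqxx (@exch_lmon _ _ _ _ s) // x1E // /D mulrA.
rewrite -/A mulrDr mulr1; congr (_ + _); rewrite -mulrA; congr (_ * _).
by rewrite (lmon_off x1 tau) B1tj ss1 expr1z x1E // mulrC.
Qed.

Let b := absz (s * B1 j i).
Let bE : b%:Z = - (s * B1 j i). Proof. by rewrite /b; lia. Qed.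

Let B2ji : B2 j i = - B1 j i. Proof. by rewrite /B2 gmutBl. Qed.
Let B2E l : l != j -> B2 l i = B1 l i + a1 l * B1 j i.
Proof.
move=> hl; rewrite /B2 (@gmutB_sign _ _ _ _ _ s) //.
have -> : pos (s * B1 j i) = 0 by rewrite /pos ltNge sji.
by rewrite mulr0 addr0.
Qed.
Let B2ii : B2 i i = 0. Proof. by rewrite B2E // B1ii a1i mul0r. Qed.
Let B2ti : B2 tau i = 0. Proof. by rewrite B2E // B1ti a1t mul0r. Qed.

Let bx2 l : [\/ l = tau, l = i, l = j | bi_in L (x2 l)].
Proof.
have [->|h1] := eqVneq l tau; first exact: Or41.
have [->|h2] := eqVneq l i; first exact: Or42.
have [->|h3] := eqVneq l j; first exact: Or43.
by apply: Or44; rewrite x2E //; apply: bx1.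
Qed.

(** The exchange polynomial at [i] before the third mutation is [W] (1 + x_j'^[b] [V]), with x_j'
    the new variable at [j]; [W1] plays the role of [W] one mutation earlier. *)
Let W := lmon x2 (fun l => pos (- s * B2 l i)).
Let V := lmon x2 (off j (fun l => s * B2 l i)).
Let W1 := lmon x1 (fun l => pos (- s * B1 l i)).

Let biW : bi_in L W.
Proof.
apply: bi_in_lmon => // l; case: (bx2 l) => [->|->|->|]; auto; left.
- by rewrite B2ti mulr0.
- by rewrite B2ii mulr0.
- by rewrite B2ji mulrNN /pos ltNge sji.
Qed.

Let biV : bi_in L V.
Proof.
apply: bi_in_lmon => // l; rewrite /off.
case: (bx2 l) => [->|->|->|]; auto; left; rewrite ?eqxx //.
- by rewrite B2ti mulr0 if_same.
- by rewrite B2ii mulr0 if_same.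
Qed.

Let biW1 : bi_in L W1.
Proof.
apply: bi_in_lmon => // l.
have [->|h1] := eqVneq l tau; first by left; rewrite B1ti mulr0.
have [->|h2] := eqVneq l i; first by left; rewrite B1ii mulr0.
by right; apply: bx1.
Qed.

(** At tau = 0 the new variable at [j] becomes [A], and the ratio of the two monomials at [i]
    returns to its value before the mutation at [j]. *)
Let VA : V * A ^+ b = lmon x1 (fun l => s * B1 l i).
Proof.
have -> : A = lmon x1 (fun l => a1 l - (l == j)%:Z).
  rewrite lmonD // mulrC; congr (_ * _).
  rewrite (lmonD1 j) eqxx big1 ?mulr1 => [|l /negbTE ->]; last by rewrite oppr0 expr0z.
  by rewrite x1E // -invr_expz.
have -> : V = lmon x1 (off j (fun l => s * B2 l i)).
  apply: eq_bigr => l _; rewrite /off; case: eqP => [//|/eqP h]; by rewrite x2E.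
rewrite -lmonX -lmonD //; apply: eq_lmon => l; rewrite /off bE.
have [->|h] := eqVneq l j; last by rewrite B2E //= subr0; ring.
rewrite /a1 B1jj mulr0 /pos ltxx /=; ring.
Qed.

(** Mutating back at [i] recovers x_i, which evaluates the exchange polynomial at [i]. *)
Let back : 1 + lmon x1 (fun l => s * B1 l i) = c * x i / W1.
Proof.
have h : gmutx i x1 B1 = x.
  by apply: (gmutxK (mut := mut)) => //; exact: nx1.
have -> : x i = gmutx i x1 B1 i by rewrite h.
rewrite /gmutx eqxx (@exch_lmon _ _ _ _ s) // -/c -/W1 mulrA mulfV ?nx1 // mul1r.
by rewrite mulrC mulrA mulVf ?mul1r // lmon_neq0.
Qed.

Let expand (k : nat) : exists2 H, Lt H & (A + D * x tau) ^+ k = A ^+ k + D * x tau * H.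
Proof.
elim: k => [|k [H LH e]]; first by exists 0; [exact: sr0 | rewrite !expr0 mulr0 addr0].
exists (A ^+ k + (A + D * x tau) * H).
  have LA : Lt A by apply: LLt; case: biA.
  apply: srD => //; first exact: srX.
  apply: srM => //; apply: srD => //; apply: srM => //; exact: LLt.
rewrite exprS e [A ^+ k.+1]exprS; ring.
Qed.

(** The third variable is [W] (1 + [V] ([A] + [D] tau)^[b]) / [c]. Its tau-free part is [W] (1 + [V]
    [A]^[b]) / [c] = [W] x_i / [W1], a unit, and the remaining part is divisible by [c] tau. *)
Lemma tracker_exchange : exists A D G H,
  [/\ bi_in L A, L D, bi_in L G & Lt H] /\ (A != 0 /\ G != 0) /\
  (gmutx j (gmutx i x B) (gmutB i B) j = A + D * x tau /\
   gmutx i (gmutx j (gmutx i x B) (gmutB i B)) (gmutB j (gmutB i B)) i = G + x tau * H).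
Proof.
(* Either [i] and [j] are linked and [c] divides [D], or the exponent [b] is 0. *)
have [H LH eH] : exists2 H, Lt H & (A + D * x tau) ^+ b = A ^+ b + c * x tau * H.
  have [e|ne] := eqVneq (B1 i j) 0.
    exists 0; first exact: sr0.
    have -> : b = 0%N by rewrite /b Bji0 // mulr0.
    by rewrite !expr0 mulr0 addr0.
  have [H LH e] := expand b; have [D' LD' eD] := Dc ne.
  exists (D' * H); first by apply: srM => //; apply: LLt.
  rewrite e eD; ring.
exists A, D, (W * x i / W1), (W * V * H); split; first split=> //.
- apply: bi_inM => //; last exact: bi_inV.
  by apply: bi_inM => //; apply: hx.
- by apply: srM => //; apply: srM => //; apply: LLt; [case: biW | case: biV].
split; first by rewrite !mulf_neq0 ?invr_eq0 ?lmon_neq0.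
split; first exact: x2j.
rewrite {1}/gmutx eqxx -/x1 -/B1 -/x2 -/B2 (@exch_lmon _ _ _ _ s) // -/W.
rewrite (lmon_off x2 j) -/V B2ji mulrN -bE -exprnP x2j eH x2E // -/c.
have nc : c != 0 by exact: nx1.
have -> : (A ^+ b + c * x tau * H) * V = V * A ^+ b + c * (x tau * H * V) by ring.
rewrite VA addrA back.
have nW : W1 != 0 by apply: lmon_neq0.
field; by rewrite nc nW.
Qed.

End ExchangeWithTracker.

(** * Specialisation of seeds and its compatibility with mutation *)

Section Specialisation.
Variables (R : comNzRingType) (E1 E2 : fieldType).
Variables (phi : {rmorphism R -> E1}) (psi : {rmorphism R -> E2}).
Hypothesis phi_neq0 : forall p, psi p != 0 -> phi p != 0.

(* [b] is the value of [a] under the place extending [phi p |-> psi p] to fractions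
   whose denominator does not specialise to [0]. *)
Definition specialises (a : E1) (b : E2) :=
  exists p q, [/\ psi q != 0, a = phi p / phi q & b = psi p / psi q].

Lemma spec_morph p : specialises (phi p) (psi p).
Proof. by exists p, 1; rewrite !rmorph1 oner_neq0 !divr1. Qed.

Lemma spec1 : specialises 1 1.
Proof. by have := spec_morph 1; rewrite !rmorph1. Qed.

Lemma specD a b c d : specialises a b -> specialises c d -> specialises (a + c) (b + d).
Proof.
case=> p [q [hq -> ->]] [p' [q' [hq' -> ->]]].
exists (p * q' + p' * q), (q * q'); rewrite !rmorphM mulf_neq0 //.
by split=> //; rewrite rmorphD !rmorphM; field; rewrite ?phi_neq0 ?hq ?hq'.
Qed.

Lemma specM a b c d : specialises a b -> specialises c d -> specialises (a * c) (b * d).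
Proof.
case=> p [q [hq -> ->]] [p' [q' [hq' -> ->]]].
exists (p * p'), (q * q'); rewrite !rmorphM mulf_neq0 //.
by split=> //; field; rewrite ?phi_neq0 ?hq ?hq'.
Qed.

Lemma spec_neq0 a b : specialises a b -> b != 0 -> a != 0.
Proof.
case=> p [q [hq -> ->]]; rewrite !mulf_eq0 !negb_or => /andP [hp _].
by rewrite invr_eq0 !phi_neq0.
Qed.

Lemma specV a b : specialises a b -> b != 0 -> specialises a^-1 b^-1.
Proof.
case=> p [q [hq -> ->]]; rewrite mulf_eq0 negb_or => /andP [hp _].
by exists q, p; split; rewrite ?invfM ?invrK ?[_ * phi q]mulrC ?[_ * psi q]mulrC.
Qed.

Lemma specX a b k : specialises a b -> specialises (a ^+ k) (b ^+ k).
Proof.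
by move=> h; elim: k => [|k IH]; [exact: spec1 | rewrite !exprS; exact: specM].
Qed.

Variable (T : finType).

Lemma spec_exch (x : T -> E1) (v : T -> E2) b :
  (forall r, specialises (x r) (v r)) -> specialises (exch x b) (exch v b).
Proof.
move=> h; apply: specD.
  apply: (big_rec2 (fun a c => specialises a c)); first exact: spec1.
  by move=> i a c _ hac; apply: specM => //; apply: specX.
apply: (big_rec2 (fun a c => specialises a c)); first exact: spec1.
by move=> i a c _ hac; apply: specM => //; apply: specX.
Qed.

(** Mutation inverts only the variable at the mutated index, so a frozen variable may specialise to
    0. *)
Lemma spec_gpath (mut : pred T) (x : T -> E1) (v : T -> E2) B :
  (forall r, specialises (x r) (v r)) ->
  (forall ks, all mut ks -> forall r, mut r -> (gpath (v, B) ks).1 r != 0) ->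
  forall ks, all mut ks -> forall r,
    specialises ((gpath (x, B) ks).1 r) ((gpath (v, B) ks).1 r).
Proof.
move=> hs hv ks; elim: ks x v B hs hv => [|k ks IH] x v B hs hv /=; first by [].
case/andP=> mk mks; apply: IH => // [r|js mjs r mr].
  rewrite /gmutx /=; case: eqP => [->|//]; apply: specM; last exact: spec_exch.
  by apply: specV => //; apply: (hv [::]).
by apply: (hv (k :: js)); rewrite //= mk.
Qed.

End Specialisation.

(** * Generated subrings and clearing of denominators *)

Section GeneratedSubring.
Variables (E : fieldType).

Inductive rgen (S : E -> Prop) : E -> Prop :=
  | rgen_base f : S f -> rgen S f
  | rgen1 : rgen S 1
  | rgenD a b : rgen S a -> rgen S b -> rgen S (a + b)
  | rgenN a : rgen S a -> rgen S (- a)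
  | rgenM a b : rgen S a -> rgen S b -> rgen S (a * b).

Lemma rgen_subring S : subring_pred (rgen S).
Proof. by split; [exact: rgen1 | exact: rgenD | exact: rgenN | exact: rgenM]. Qed.

(** The elements brought into [M] by some power of [w] form a ring, so the generators decide. *)
Lemma rgen_clear_denom (M S : E -> Prop) w : subring_pred M -> M w ->
  (forall s, S s -> exists N : nat, M (s * w ^+ N)) ->
  forall f, rgen S f -> exists N : nat, M (f * w ^+ N).
Proof.
move=> hM Mw hS f; elim=> {f} [f /hS //||a b _ [N hN] _ [N' hN']|a _ [N hN]|a b _ [N hN] _ [N' hN']].
- by exists 0%N; rewrite mulr1; exact: sr1.
- exists (N + N')%N; rewrite exprD mulrDl; apply: srD => //.
    by rewrite mulrA; apply: srM => //; apply: srX.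
  by rewrite mulrCA mulrC; apply: srM => //; apply: srX.
- by exists N; rewrite mulNr; apply: srN.
- by exists (N + N')%N; rewrite exprD mulrACA; apply: srM.
Qed.

(** No scalars are adjoined, so these are Laurent polynomials with integer coefficients. *)
Definition zlaurent (T : finType) (x : T -> E) : E -> Prop :=
  rgen (fun f => exists i, f = x i \/ f = (x i)^-1).

Lemma zlaurent_bi (T : finType) (x : T -> E) i : bi_in (zlaurent x) (x i).
Proof. by split; apply: rgen_base; exists i; auto. Qed.

End GeneratedSubring.

(** * Adjoining one frozen variable to a seed *)

Section Tracker.
Variables (E : fieldType) (T : finType).

Definition opt_mut (mut : pred T) : pred (option T) := fun o => if o is Some k then mut k else false.

Definition optB (B : T -> T -> int) (j : T) (s : int) : option T -> option T -> int :=
  fun a b => match a, b with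
    | Some k, Some l => B k l
    | None, Some l => if l == j then s else 0
    | _, None => 0
    end.

Definition optx (E' : Type) (t : E') (x : T -> E') (o : option T) : E' :=
  if o is Some k then x k else t.

Lemma big_option_prod (G : option T -> E) :
  \prod_o G o = G None * \prod_k G (Some k).
Proof.
rewrite (bigD1 None) //=; congr (_ * _).
rewrite (reindex_omap Some id) //=; first by apply: eq_bigl => k; rewrite eqxx.
by case.
Qed.

Lemma exch_opt (y : option T -> E) (x : T -> E) (bo : option T -> int) b :
  y None = 1 -> (forall r, y (Some r) = x r) -> (forall r, bo (Some r) = b r) ->
  exch y bo = exch x b.
Proof.
move=> h0 h1 hb; rewrite /exch !pos_monomial !neg_monomial /lmon !big_option_prod h0 !exp1rz !mul1r.
by congr (_ + _); apply: eq_bigr => k _; rewrite h1 hb.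
Qed.

(** A frozen variable of value 1 contributes nothing to exchange monomials, so the enlarged seed
    runs in parallel with the original one. *)
Lemma gpath_opt mut (So : gseed E (option T)) (S : gseed E T) ks :
  all mut ks ->
  So.1 None = 1 -> (forall r, So.1 (Some r) = S.1 r) ->
  (forall a b, So.2 (Some a) (Some b) = S.2 a b) ->
  (gpath So (map Some ks)).1 None = 1 /\
  forall r, (gpath So (map Some ks)).1 (Some r) = (gpath S ks).1 r.
Proof.
elim: ks So S => //= k ks IH So S /andP [mk mks] h0 h1 hB.
apply: IH => //= [r|a b].
  rewrite /gmutx /= -[Some r == Some k]/(r == k) h1; case: eqP => // _.
  by congr (_ * _); apply: exch_opt.
by rewrite /gmutB -[Some a == Some k]/(a == k) -[Some b == Some k]/(b == k) !hB.
Qed.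

Lemma opt_mutP mut (ks : seq (option T)) : all (opt_mut mut) ks ->
  exists2 js, ks = map Some js & all mut js.
Proof.
elim: ks => [|[k|] ks IH] //=; first by exists [::].
by case/andP=> mk /IH [js -> mjs]; exists (k :: js); rewrite //= mk.
Qed.

Lemma skewable_opt mut B j s : skewable mut B -> skewable (opt_mut mut) (optB B j s).
Proof.
case=> d [dp h]; exists (fun o => if o is Some k then d k else 1); split.
  by case=> // k; apply: dp.
by case=> // a; case=> // b; apply: h.
Qed.

(** The constant term of [v] being a unit, the coefficients of [g] are recovered recursively from
    those of [g * v], and divisibility by [d] is inherited. This stands in for coprimality of [d]
    and [v]. *)
Lemma coef_divisible (M : E -> Prop) (g v : {poly E}) d : subring_pred M ->
  (forall k, M v`_k) -> bi_in M v`_0 -> v`_0 != 0 ->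
  (forall k, exists2 a, M a & (g * v)`_k = d * a) ->
  forall k, exists2 a, M a & g`_k = d * a.
Proof.
move=> hM Mv Mv0 nz h k; have [n] := ubnP k; elim: n k => // n IH k /ltnSE hk.
have [a Ma] := h k; rewrite coefM big_ord_recr /= subnn => e.
have [b Mb eb] : exists2 b, M b & \sum_(l < k) g`_l * v`_(k - l) = d * b.
  apply: (big_ind (fun u => exists2 b, M b & u = d * b)).
  - by exists 0; rewrite ?mulr0 //; exact: sr0.
  - by move=> u1 u2 [b1 M1 ->] [b2 M2 ->]; exists (b1 + b2); rewrite ?mulrDr //; exact: srD.
  - move=> l _; have [b Mb ->] := IH l (leq_trans (ltn_ord l) hk).
    by exists (b * v`_(k - l)); rewrite ?mulrA //; apply: srM.
exists ((a - b) / v`_0).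
  apply: srM => //; last by case: Mv0.
  by apply: srD => //; apply: srN.
by rewrite mulrA mulrBr -e eb addrAC subrr add0r mulfK.
Qed.

End Tracker.

(** * Polynomials in the adjoined variable with coefficients in a subring *)

Section PolynomialCoefficients.
Variables (E : fieldType) (M : E -> Prop).
Hypothesis hM : subring_pred M.

Definition const_in (f : {fraction {poly E}}) := exists2 a, M a & f = tofrac a%:P.
Definition poly_in (f : {fraction {poly E}}) :=
  exists2 p : {poly E}, (forall k, M p`_k) & f = tofrac p.

Lemma const_in_subring : subring_pred const_in.
Proof.
split.
- by exists 1; [exact: sr1 | rewrite tofrac1].
- by move=> _ _ [a Ma ->] [b Mb ->]; exists (a + b); rewrite ?polyCD ?tofracD //; exact: srD.
- by move=> _ [a Ma ->]; exists (- a); rewrite ?polyCN ?tofracN //; exact: srN.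
- by move=> _ _ [a Ma ->] [b Mb ->]; exists (a * b); rewrite ?polyCM ?tofracM //; exact: srM.
Qed.

Lemma poly_in_subring : subring_pred poly_in.
Proof.
split.
- exists 1; last by rewrite tofrac1.
  by move=> k; rewrite coef1; case: eqP => _; [exact: sr1 | exact: sr0].
- move=> _ _ [p hp ->] [q hq ->]; exists (p + q); last by rewrite tofracD.
  by move=> k; rewrite coefD; exact: srD.
- move=> _ [p hp ->]; exists (- p); last by rewrite tofracN.
  by move=> k; rewrite coefN; exact: srN.
- move=> _ _ [p hp ->] [q hq ->]; exists (p * q); last by rewrite tofracM.
  move=> k; rewrite coefM; apply: (big_ind M); [exact: sr0|exact: srD|].
  by move=> i _; exact: srM.
Qed.

Lemma const_poly_in f : const_in f -> poly_in f.
Proof.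
case=> a Ma ->; exists a%:P => // k; rewrite coefC; case: eqP => // _; exact: sr0.
Qed.

Lemma poly_inX : poly_in (tofrac 'X).
Proof. by exists 'X => // k; rewrite coefX; case: eqP => _; [exact: sr1 | exact: sr0]. Qed.

Lemma tofracVC (a : E) : (tofrac a%:P)^-1 = tofrac (a^-1)%:P :> {fraction {poly E}}.
Proof.
have [->|nz] := eqVneq a 0; first by rewrite polyC0 tofrac0 !invr0 polyC0 tofrac0.
apply: (mulfI (x := tofrac a%:P)); first by rewrite tofrac_eq0 polyC_eq0.
by rewrite mulfV ?tofrac_eq0 ?polyC_eq0 // -tofracM -polyCM mulfV // tofrac1.
Qed.

End PolynomialCoefficients.

(** The two expressions of [f] give an identity of polynomials, which can be evaluated at 1; the
    value thus does not depend on the fraction chosen. *)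
Lemma frac_poly_at1 (E : fieldType) (f : {fraction {poly E}}) (c : E) (g p q : {poly E}) N :
  c != 0 -> f * (tofrac c%:P * tofrac 'X) ^+ N = tofrac g ->
  f = tofrac p / tofrac q -> q.[1] != 0 -> p.[1] / q.[1] = (c ^- N *: g).[1].
Proof.
move=> nc eg ef nq; have nq0 : q != 0 by apply: contraNneq nq => ->; rewrite horner0.
have e : p * (c%:P * 'X) ^+ N = g * q.
  apply/eqP; rewrite -tofrac_eq !tofracM tofracXn tofracM -eg ef.
  by rewrite [X in _ == X]mulrAC divfK // tofrac_eq0.
have := congr1 (horner^~ 1) e; rewrite !hornerM horner_exp hornerM hornerC hornerX mulr1 => e1.
rewrite hornerZ; apply: (mulIf (x := q.[1] * c ^+ N)); first by rewrite mulf_neq0 ?expf_neq0.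
have nN : c ^+ N != 0 by rewrite expf_neq0.
by rewrite mulrA divfK // e1; field.
Qed.

(** * The inductive step of the Laurent phenomenon *)

Section LaurentStep.
Variables (E : fieldType) (T : finType) (mut : pred T) (x : T -> E) (B : T -> T -> int).
Variables (i j : T) (rest : seq T).
Hypotheses (sk : skewable mut B) (nv : nonvanishing mut (x, B)).
Hypotheses (mi : mut i) (mj : mut j) (nij : i != j) (mrest : all mut rest).

(** With this sign the adjoined variable stands in the same monomial as the new variable at [i], if
    the latter occurs, in the exchange relation at [j]. *)
Let s : int := if 0 <= gmutB i B i j then 1 else -1.
Let Ex : fieldType := {fraction {poly E}}.
Let t : Ex := tofrac 'X.
Let xo : option T -> Ex := optx t (fun l => tofrac (x l)%:P).
Let Bo := optB B j s.
Let vo : option T -> E := optx 1 x.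

Let ev1 : {rmorphism {poly E} -> E} := horner_eval 1.
Let fr : {rmorphism {poly E} -> Ex} := @tofrac _.

Let fr_neq0 p : ev1 p != 0 -> fr p != 0.
Proof.
apply: contraNneq => /eqP; rewrite tofrac_eq0 => /eqP ->.
by rewrite rmorph0.
Qed.

Let vo_path ks : all mut ks -> forall r, (gpath (vo, Bo) (map Some ks)).1 r != 0.
Proof.
move=> mks.
have [h0 h1] := @gpath_opt E T mut (vo, Bo) (x, B) ks mks erefl (fun=> erefl) (fun _ _ => erefl).
by case=> [r|]; [rewrite h1; apply: nv | rewrite h0 oner_neq0].
Qed.

Let spec_path ks : all mut ks -> forall r,
  specialises fr ev1 ((gpath (xo, Bo) (map Some ks)).1 r) ((gpath (vo, Bo) (map Some ks)).1 r).
Proof.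
move=> mks; apply: (@spec_gpath _ _ _ fr ev1 fr_neq0 _ (opt_mut mut)).
- case=> [r|] /=.
    by have := spec_morph fr ev1 (x r)%:P; rewrite /= /horner_eval hornerC.
  by have := spec_morph fr ev1 'X; rewrite /= /horner_eval hornerX.
- by move=> js /opt_mutP [ks' -> mk] r _; apply: vo_path.
- by rewrite all_map.
Qed.

(** At t = 1 the enlarged seed specialises to the original one, whose variables never vanish. *)
Let nvo : nonvanishing (opt_mut mut) (xo, Bo).
Proof.
move=> js /opt_mutP [ks' -> mk] r.
exact: (spec_neq0 fr_neq0 (spec_path mk r) (vo_path mk r)).
Qed.

Let sko : skewable (opt_mut mut) Bo. Proof. exact: skewable_opt. Qed.

Let Z := zlaurent x.
Let hZ : subring_pred Z. Proof. exact: rgen_subring. Qed.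
Let L := const_in Z.
Let Lt := poly_in Z.
Let hL : subring_pred L. Proof. exact: const_in_subring. Qed.
Let hLt : subring_pred Lt. Proof. exact: poly_in_subring. Qed.
Let LLt a : L a -> Lt a. Proof. exact: const_poly_in. Qed.

Let biL a : bi_in Z a -> bi_in L (tofrac a%:P).
Proof. by case=> h1 h2; split; [exists a | exists a^-1; rewrite ?tofracVC]. Qed.

Let hxo o : o != None -> bi_in L (xo o).
Proof. by case: o => // r _; apply: biL; apply: zlaurent_bi. Qed.

Let S1 := gmut (xo, Bo) (Some i).
Let S2 := gmut S1 (Some j).
Let S3 := gmut S2 (Some i).
Let c := S1.1 (Some i).

Let Bo1 : gmutB (Some i) Bo (Some i) (Some j) = gmutB i B i j.
Proof. by []. Qed.

Let hs : (s == 1) || (s == -1). Proof. by rewrite /s; case: ifP. Qed.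
Let hsij : 0 <= s * gmutB (Some i) Bo (Some i) (Some j).
Proof. by rewrite Bo1 /s; case: ifP => h; lia. Qed.

Let Lc : L c.
Proof.
apply: (@tracker_first _ _ xo Bo (opt_mut mut) (Some i) None L) => //=.
by rewrite (negbTE nij).
Qed.

Let tracker : exists A D G H, [/\ bi_in L A, L D, bi_in L G & Lt H] /\ (A != 0 /\ G != 0) /\
  (S2.1 (Some j) = A + D * t /\ S3.1 (Some i) = G + t * H).
Proof.
apply: (@tracker_exchange _ _ xo Bo (opt_mut mut) (Some i) (Some j) None s L Lt) => //=.
- exact: poly_inX.
- by rewrite (negbTE nij).
- by rewrite eqxx.
Qed.

Let t_neq0 : t != 0. Proof. by rewrite tofrac_eq0 polyX_eq0. Qed.
Let c_neq0 : c != 0. Proof. by apply: (nvo (ks := [:: Some i])); rewrite /= mi. Qed.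

Let Lt_t : Lt t. Proof. exact: poly_inX. Qed.

(** After the first mutation only [c] and t can fail to be units among the variables, so powers of
    [c * t] clear all denominators; after the third mutation [u * t] does the same. *)
Let clear1 f : zlaurent S1.1 f -> exists N : nat, Lt (f * (c * t) ^+ N).
Proof.
have Ltc : Lt c by apply: LLt.
apply: rgen_clear_denom => //; first exact: srM.
move=> f0 [o ho].
have [e|ne] := eqVneq o (Some i).
  by case: ho => ->; rewrite e; [exists 0%N; rewrite mulr1 | exists 1%N; rewrite expr1 mulKf].
have e : S1.1 o = xo o by rewrite /S1 /gmut /gmutx /= (negbTE ne).
case: o e ho ne => [r|] e ho ne.
  have [h1 h2] := hxo (o := Some r) isT.
  by exists 0%N; rewrite mulr1; case: ho => ->; rewrite e; apply: LLt.
by case: ho => ->; rewrite e; [exists 0%N; rewrite mulr1 | exists 1%N; rewrite expr1 mulrC mulfK].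
Qed.

Let u := S2.1 (Some j) * S3.1 (Some i).

Let S2j_neq0 : S2.1 (Some j) != 0.
Proof. by apply: (nvo (ks := [:: Some i; Some j])); rewrite /= mi mj. Qed.
Let S3i_neq0 : S3.1 (Some i) != 0.
Proof. by apply: (nvo (ks := [:: Some i; Some j; Some i])); rewrite /= mi mj. Qed.

Let clear3 f : zlaurent S3.1 f -> exists N : nat, Lt (f * (u * t) ^+ N).
Proof.
have [A [D [G [H [[[LA _] LD [LG _] LH] [_ [e2 e3]]]]]]] := tracker.
have L2 : Lt (S2.1 (Some j)).
  by rewrite e2; apply: srD => //; [exact: LLt | apply: srM => //; exact: LLt].
have L3 : Lt (S3.1 (Some i)).
  by rewrite e3; apply: srD => //; [exact: LLt | apply: srM => //; exact: LLt].
have Lu : Lt u by apply: srM.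
apply: rgen_clear_denom => //; first exact: srM.
move=> f0 [o ho].
have [e|ne] := eqVneq o (Some i).
  case: ho => ->; rewrite e; first by exists 0%N; rewrite mulr1.
  by exists 1%N; rewrite expr1 /u mulrAC mulrC mulfK //; apply: srM.
have [e|ne'] := eqVneq o (Some j).
  have e' : S3.1 (Some j) = S2.1 (Some j).
    have nji : Some j != Some i by apply: contraNneq nij => -[->].
    by rewrite /S3 /gmut /gmutx /= (negbTE nji).
  case: ho => ->; rewrite e e'; first by exists 0%N; rewrite mulr1.
  by exists 1%N; rewrite expr1 /u -mulrA mulKf //; apply: srM.
have e : S3.1 o = xo o by rewrite /S3 /S2 /S1 /gmut /gmutx /= (negbTE ne) (negbTE ne').
case: o e ho ne ne' => [r|] e ho ne ne'.
  have [h1 h2] := hxo (o := Some r) isT.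
  by exists 0%N; rewrite mulr1; case: ho => ->; rewrite e; apply: LLt.
by case: ho => ->; rewrite e; [exists 0%N; rewrite mulr1 | exists 1%N; rewrite expr1 mulrC mulfK].
Qed.

Let ext := gpath (xo, Bo) (map Some [:: i, j & rest]).

(* A final cluster variable lies in [Z[t]] after multiplication by a power of [c t] and
   also by a power of [u t]. The constant coefficient of [u] is a unit of [Z] while [c] is
   free of [t], so coefficient by coefficient the denominator [c] disappears; [t = 1]
   recovers the original seed. *)
Lemma laurent_step :
  (forall (S : gseed {fraction {poly E}} (option T)) ks,
     skewable (opt_mut mut) S.2 -> nonvanishing (opt_mut mut) S ->
     size ks = (size rest).+1 -> all (opt_mut mut) ks ->
     forall r, zlaurent S.1 ((gpath S ks).1 r)) ->
  forall r, zlaurent x ((gpath (x, B) [:: i, j & rest]).1 r).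
Proof.
move=> IH r.
have sk1 : skewable (opt_mut mut) S1.2 by apply: (skewable_mut (k := Some i)).
have sk2 : skewable (opt_mut mut) S2.2 by apply: (skewable_mut (k := Some j)).
have mpath js : all mut js -> all (opt_mut mut) (map Some js) by rewrite all_map.
have nv1 : nonvanishing (opt_mut mut) S1.
  by apply: (nonvanishing_gpath (ks := [:: Some i]) _ nvo); rewrite /= mi.
have nv2 : nonvanishing (opt_mut mut) S2.
  by apply: (nonvanishing_gpath (ks := [:: Some i; Some j]) _ nvo); rewrite /= mi mj.
have nv3 : nonvanishing (opt_mut mut) S3.
  by apply: (nonvanishing_gpath (ks := [:: Some i; Some j; Some i]) _ nvo); rewrite /= mi mj.
have mji : all mut (j :: rest) /\ all mut (i :: rest) by rewrite /= mi mj.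
have h1 o : zlaurent S1.1 (ext.1 o).
  have -> : ext = gpath S1 (map Some (j :: rest)) by [].
  exact: (IH S1 (map Some (j :: rest)) sk1 nv1 (size_map _ _) (mpath _ mji.1) o).
(* Another mutation at [i] undoes the third one, so from [S3] the target is reached by a path of the
   same length as from [S1], and the induction hypothesis applies to both. *)
have h3 o : zlaurent S3.1 (ext.1 o).
  have -> : ext = gpath S3 (map Some (i :: rest)).
    have mio : opt_mut mut (Some i) by [].
    by rewrite /= -/S3 /S3 (gmutK mio sk2 nv2).
  have sk3 : skewable (opt_mut mut) S3.2 by apply: (skewable_mut (k := Some i)).
  exact: (IH S3 (map Some (i :: rest)) sk3 nv3 (size_map _ _) (mpath _ mji.2) o).
have [N1 [g Zg eg]] := clear1 (h1 (Some r)).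
have [N3 [h Zh eh]] := clear3 (h3 (Some r)).
have [c0 Zc0 ec] := Lc.
have [A [D [G [H [[[[A0 ZA eA] ZA'] [D0 ZD eD] [[G0 ZG eG] ZG'] [H0 ZH eH]] [[nA nG] [e2 e3]]]]]]] := tracker.
pose v := (A0%:P + D0%:P * 'X) * (G0%:P + 'X * H0) : {poly E}.
have eu : u = tofrac v.
  by rewrite /u e2 e3 eA eD eG eH /t /v -!(tofracM, tofracD).
have Zv : forall k, Z v`_k.
  have: Lt u.
    rewrite /u e2 e3; apply: srM => //; apply: srD => //.
    - by rewrite eA; apply: LLt; exists A0.
    - by apply: srM => //; apply: LLt; exists D0.
    - by rewrite eG; apply: LLt; exists G0.
    - by apply: srM => //; exists H0.
  by case=> v' Zv'; rewrite eu => /eqP; rewrite tofrac_eq => /eqP ->.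
have ev0 : v`_0 = A0 * G0.
  by rewrite coefM big_ord1 !coefD coefXM coefMX !coefC /= !addr0.
have inj (a : {poly E}) b : tofrac a = tofrac b -> a = b.
  by move/eqP; rewrite tofrac_eq => /eqP.
clearbody v.
have nA0 : A0 != 0 by move: nA; rewrite eA tofrac_eq0 polyC_eq0.
have nG0 : G0 != 0 by move: nG; rewrite eG tofrac_eq0 polyC_eq0.
have nc0 : c0 != 0 by move: c_neq0; rewrite ec tofrac_eq0 polyC_eq0.
have toZ a : L (tofrac a%:P)^-1 -> Z a^-1.
  by case=> b Zb; rewrite tofracVC => /inj /polyC_inj ->.
have key : g * (v * 'X) ^+ N3 = (c0%:P * 'X) ^+ N1 * h.
  apply: inj; rewrite !tofracM !tofracXn !tofracM -eu -ec -eg -eh mulrAC mulrC.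
  by rewrite -/t.
have bv : bi_in Z (v`_0).
  rewrite ev0; apply: bi_inM => //; split=> //; apply: toZ; [rewrite -eA|rewrite -eG] => //.
have bvN k : (v ^+ k)`_0 = v`_0 ^+ k by rewrite -!horner_coef0 horner_exp.
have Zvk k l : Z (v ^+ k)`_l.
  have [p Zp e] : poly_in Z (tofrac (v ^+ k)).
    by rewrite tofracXn; apply: srX => //; exists v.
  by rewrite (inj _ _ e).
have div : forall k, exists2 a, Z a & g`_k = c0 ^+ N1 * a.
  apply: (@coef_divisible _ Z g (v ^+ N3)) => //.
  - by rewrite bvN; apply: bi_inX.
  - by rewrite bvN expf_neq0 // ev0 mulf_neq0.
  (* Reading the coefficient at [k + N3] removes the factor X^N3 on the left, while every
     coefficient on the right carries the factor c0^N1. *)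
  - move=> k; have := congr1 (fun p : {poly E} => p`_(k + N3)) key.
    rewrite exprMn mulrA coefMXn ltnNge leq_addl /= addnK => ->.
    rewrite exprMn -mulrA -polyC_exp coefCM.
    exists ('X^N1 * h)`_(k + N3) => //.
    rewrite coefXnM; case: ifP => _ //; exact: sr0.
pose g' := (c0 ^- N1) *: g.
have Zg' k : Z g'`_k.
  by rewrite coefZ; have [a Za ->] := div k; rewrite mulKf // expf_neq0.
have mks : all mut [:: i, j & rest] by rewrite /= mi mj.
have [p [q [hq ef ev]]] := spec_path mks (Some r).
have [_ hv] := @gpath_opt E T mut (vo, Bo) (x, B) _ mks erefl (fun=> erefl) (fun _ _ => erefl).
rewrite -hv ev.
have -> : ev1 p / ev1 q = g'.[1].
  apply: (@frac_poly_at1 _ _ _ _ _ _ _ nc0 _ ef hq).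
  by move: eg; rewrite ec.
rewrite horner_coef; apply: (big_ind Z); [exact: sr0 | exact: srD |] => l _.
by rewrite expr1n mulr1.
Qed.

End LaurentStep.

(* Induction on the length of the mutation path, over all seeds at once, because the
   step enlarges the seed by a frozen variable. *)
Theorem laurent_phenomenon (E : fieldType) (T : finType) (mut : pred T)
  (x : T -> E) (B : T -> T -> int) : skewable mut B -> nonvanishing mut (x, B) ->
  forall ks, all mut ks -> forall r, zlaurent x ((gpath (x, B) ks).1 r).
Proof.
move=> sk nv ks; have [N] := ubnP (size ks).
elim: N E T mut x B sk nv ks => // N IH E T mut x B sk nv.
have hZ : subring_pred (zlaurent x) by exact: rgen_subring.
case=> [_ _ r|i [_ /andP [mi _] r|j rest hN]].
- by case: (zlaurent_bi x r).
- rewrite /= /gmutx; case: eqP => _; last by case: (zlaurent_bi x r).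
  apply: srM => //; first by case: (zlaurent_bi x r).
  by apply: srD => //; apply: sr_prod => // l _; apply: srX => //; case: (zlaurent_bi x l).
case/and3P=> mi mj mrest r.
have [eij|nij] := eqVneq i j.
  rewrite -eij /= (gmutK (mut := mut)) //; apply: (IH _ _ mut) => //.
  by move: hN; rewrite /=; lia.
apply: (@laurent_step _ _ mut) => // S ks sk' nv' hks mks; case: S sk' nv' => x' B' sk' nv'.
by apply: (IH _ _ (opt_mut mut)) => //; rewrite hks; move: hN; rewrite /=; lia.
Qed.

(** * Variables as primes and factors of monomials in polynomial rings *)

Section MultivariatePolynomials.
Variables (R : idomainType) (n : nat).
Implicit Types (p q r : {mpoly R[n]}) (g : 'X_{1..n}).

Lemma mpoly_closed_ind (P : {mpoly R[n]} -> Prop) :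
  (forall c, P c%:MP) -> (forall i, P 'X_i) ->
  (forall p q, P p -> P q -> P (p + q)) -> (forall p q, P p -> P q -> P (p * q)) ->
  forall p, P p.
Proof.
move=> hC hX hD hM p; rewrite (mpolyE p).
apply: (big_ind P) => [||g _]; [|exact: hD|]; first by rewrite -(mpolyC0 n); exact: hC.
rewrite -mul_mpolyC; apply: (hM) => //; rewrite mpolyXE_id.
apply: (big_ind P) => [||i _]; [|exact: hM|]; first by rewrite -(mpolyC1 n); exact: hC.
elim: (g i) => [|d IH]; first by rewrite expr0 -(mpolyC1 n); exact: hC.
by rewrite exprS; apply: hM.
Qed.

Definition kill (k : 'I_n) (i : 'I_n) : {mpoly R[n]} := if i == k then 0 else 'X_i.

Definition mkill k : {rmorphism {mpoly R[n]} -> {mpoly R[n]}} :=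
  mmap (@mpolyC n R) (kill k).

Lemma mkillX k : mkill k 'X_k = 0.
Proof. by rewrite /mkill /= mmapX mmap1U /kill eqxx. Qed.

Lemma mkill_dvd k p : mkill k p = 0 -> exists q, p = 'X_k * q.
Proof.
suff [q e] : exists q, p = mkill k p + 'X_k * q by exists q; rewrite e H add0r.
elim/mpoly_closed_ind: p => [c|i|p p' [q e] [q' e']|p p' [q e] [q' e']].
- by exists 0; rewrite /mkill /= mmapC mulr0 addr0.
- rewrite /mkill /= mmapX mmap1U /kill; case: eqP => [->|_].
    by exists 1; rewrite add0r mulr1.
  by exists 0; rewrite mulr0 addr0.
- by exists (q + q'); rewrite rmorphD mulrDr addrACA -e -e'.
- exists (mkill k p * q' + q * p'); rewrite rmorphM.
  by move: (mkill k p) (mkill k p') e e' => a b -> ->; ring.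
Qed.

(** Setting X_k = 0 maps to a domain, with kernel generated by X_k. *)
Lemma mX_prime k p q r : p * q = 'X_k * r ->
  (exists p', p = 'X_k * p') \/ (exists q', q = 'X_k * q').
Proof.
move=> e; have := congr1 (mkill k) e.
rewrite !rmorphM mkillX mul0r => /eqP; rewrite mulf_eq0.
by case/orP => /eqP /mkill_dvd; auto.
Qed.

Lemma mX_neq0 k : 'X_k != 0 :> {mpoly R[n]}.
Proof. by rewrite -msize_poly_eq0 msizeX. Qed.

(** Variables are prime, so they are stripped off the product one by one; when none is left, both
    factors have degree 0. *)
Lemma monomial_factor p q c g : c != 0 -> p * q = c *: 'X_[g] ->
  exists d d' gp gq, [/\ p = d *: 'X_[gp], q = d' *: 'X_[gq], d * d' = c & (gp + gq)%MM = g].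
Proof.
move=> nc; have [N] := ubnP (mdeg g); elim: N g p q => // N IH g p q hN e.
have [g0|ng] := altP (@eqP _ g 0%MM).
  move: e; rewrite g0 mpolyX0 alg_mpolyC => e.
  have npq : p * q != 0 by rewrite e mpolyC_eq0.
  move: (npq); rewrite mulf_eq0 negb_or => /andP [np nq].
  have := msizeM np nq; rewrite e msizeC nc => hsz.
  have sp : msize p = 1%N by move: hsz (mpolySpred mdeg np) (mpolySpred mdeg nq); lia.
  have sq : msize q = 1%N by move: hsz (mpolySpred mdeg np) (mpolySpred mdeg nq); lia.
  move/eqP/msize_poly1P: sp => [d _ ed]; move/eqP/msize_poly1P: sq => [d' _ ed'].
  exists d, d', 0%MM, 0%MM; rewrite mpolyX0 !alg_mpolyC addm0; split=> //.
  by have := congr1 (fun p : {mpoly R[n]} => p@_0%MM) e; rewrite ed ed' -mpolyCM !mpolyCK.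
have [k gk] : exists k, g k != 0%N.
  apply/existsP; apply: contraNT ng; rewrite negb_exists => /forallP h.
  by apply/eqP/mnmP => i; rewrite mnm0E; apply/eqP; have := h i; rewrite negbK.
have eg : g = (U_(k) + (g - U_(k)))%MM by rewrite addmC submK // lep1mP.
have hd : (mdeg (g - U_(k))%MM < N)%N by move: hN; rewrite {1}eg mdegD mdeg1; lia.
have hX : c *: 'X_[g] = 'X_k * (c *: 'X_[g - U_(k)]) :> {mpoly R[n]}.
  by rewrite {1}eg mpolyXD scalerAr.
have eX := etrans e hX.
case: (mX_prime eX) => [[p' ep]|[q' eq]].
  have e' : p' * q = c *: 'X_[g - U_(k)].
    by apply: (mulfI (mX_neq0 k)); rewrite mulrA -ep.
  have [d [d' [gp [gq [h1 h2 h3 h4]]]]] := IH _ _ _ hd e'.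
  exists d, d', (U_(k) + gp)%MM, gq; split=> //; first by rewrite ep h1 mpolyXD scalerAr.
  by rewrite -addmA h4 -eg.
have e' : p * q' = c *: 'X_[g - U_(k)].
  by apply: (mulfI (mX_neq0 k)); rewrite mulrCA -eq.
have [d [d' [gp [gq [h1 h2 h3 h4]]]]] := IH _ _ _ hd e'.
exists d, d', gp, (U_(k) + gq)%MM; split=> //; first by rewrite eq h2 mpolyXD scalerAr.
by rewrite addmC -addmA [(gq + gp)%MM]addmC h4 -eg.
Qed.

End MultivariatePolynomials.

(** * Algebraic independence under mutation *)

Section AlgebraicIndependence.
Variables (R : idomainType) (E : fieldType) (h : {rmorphism R -> E}) (m : nat).
Implicit Types (y : 'I_m -> E) (b : 'I_m -> int) (B : 'I_m -> 'I_m -> int).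

Definition algindep y := forall q, mmap h y q = 0 -> q = 0.

Lemma algindep_inj y p q : algindep y -> mmap h y p = mmap h y q -> p = q.
Proof.
by move=> ai e; apply/eqP; rewrite -subr_eq0; apply/eqP/ai; rewrite mmapB e subrr.
Qed.

Lemma mmap_mX y i : mmap h y 'X_i = y i.
Proof. by rewrite mmapX mmap1U. Qed.

Lemma algindep_neq0 y i : algindep y -> y i != 0.
Proof.
move=> ai; apply: contraTneq isT => e; have := ai 'X_i; rewrite mmap_mX e => /(_ erefl) /eqP.
by rewrite (negbTE (mX_neq0 _ _)).
Qed.

Definition pos_mnm b : 'X_{1..m} := [multinom (if (0 < b i)%R then absz (b i) else 0%N) | i < m].
Definition neg_mnm b : 'X_{1..m} := [multinom (if (b i < 0)%R then absz (b i) else 0%N) | i < m].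
Definition exch_poly b : {mpoly R[m]} := 'X_[pos_mnm b] + 'X_[neg_mnm b].

Lemma exch_polyE y b : mmap h y (exch_poly b) = exch y b.
Proof.
rewrite mmapD !mmapX /mmap1 /exch; congr (_ + _); rewrite [RHS]big_mkcond;
  by apply: eq_bigr => i _; rewrite mnmE; case: ifP; rewrite ?expr0.
Qed.

(** A nonzero entry of the column makes the two exponent vectors different, so two coefficients
    equal to 1 survive. *)
Lemma exch_poly_not_monomial b c g : (exists i, b i != 0) -> exch_poly b != c *: 'X_[g].
Proof.
case=> i bi; apply/eqP => e.
have npn : pos_mnm b != neg_mnm b.
  apply/eqP => /mnmP /(_ i); rewrite !mnmE; case: ltgtP bi => // hb _ e0; lia.
have npn' : (neg_mnm b == pos_mnm b) = false by rewrite eq_sym (negbTE npn).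
have co g' := congr1 (fun p : {mpoly R[m]} => p@_g') e.
have := co (pos_mnm b); have := co (neg_mnm b).
rewrite !mcoeffD !mcoeffZ !mcoeffX !eqxx (negbTE npn) npn' !mulr0n add0r addr0.
case: (g =P neg_mnm b) => [->|_ /eqP]; last by rewrite mulr0 oner_eq0.
by rewrite npn' mulr0 => _ /eqP; rewrite oner_eq0.
Qed.

(* Clearing denominators is uniform in the point [v], so it applies both to a cluster
   and to its mutation; mutating twice then returns to the original polynomial. *)
Lemma mmap_gmutx k B (q : {mpoly R[m]}) : exists (r : {mpoly R[m]}) d, forall v,
  v k != 0 -> mmap h (gmutx k v B) q * v k ^+ d = mmap h v r.
Proof.
elim/mpoly_closed_ind: q => [c|i|p p' [r [d e]] [r' [d' e']]|p p' [r [d e]] [r' [d' e']]].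
- by exists c%:MP, 0%N => v _; rewrite mulr1 !mmapC.
- have [->|ne] := eqVneq i k.
    exists (exch_poly (B^~ k)), 1%N => v nv.
    by rewrite mmap_mX exch_polyE /gmutx eqxx expr1 mulrC mulVKf.
  exists 'X_i, 0%N => v nv; rewrite mulr1 !mmap_mX /gmutx (negbTE ne) //.
- exists (r * 'X_k ^+ d' + r' * 'X_k ^+ d), (d + d')%N => v nv.
  rewrite !(rmorphD, rmorphM, rmorphXn) /= !mmap_mX -e // -e' // exprD; ring.
- exists (r * r'), (d + d')%N => v nv.
  by rewrite !rmorphM /= -e // -e' // exprD mulrACA.
Qed.

(** A relation [q] of the mutated tuple clears to a polynomial [r] vanishing at [y], so [r = 0]. The
    same clearing at the mutated tuple, whose own mutation is [y], then gives q(y) = 0. *)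
Lemma algindep_mut (mut : pred 'I_m) k y B : mut k -> skewable mut B ->
  gmutx k y B k != 0 -> algindep y -> algindep (gmutx k y B).
Proof.
move=> mk sk nz ai q e; have [r [d er]] := mmap_gmutx k B q.
have nk : y k != 0 by apply: algindep_neq0.
have r0 : r = 0 by apply: ai; rewrite -er // e mul0r.
have gE : gmutx k (gmutx k y B) B = y.
  rewrite -[RHS](gmutxK mk sk nz); apply: functional_extensionality => i.
  rewrite /gmutx; case: eqP => // _; congr (_ * _).
  by rewrite -exchN; congr exch; apply: functional_extensionality => l; rewrite gmutBr.
have := er _ nz; rewrite gE r0 rmorph0 => /eqP; rewrite mulf_eq0 expf_eq0 (negbTE nz) andbF orbF.
by move/eqP/ai.
Qed.

Lemma mmap1_lmon y g : mmap1 y g = lmon y (fun i => (g i)%:Z).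
Proof. by apply: eq_bigr => i _; rewrite exprnP. Qed.

End AlgebraicIndependence.

(** * Positivity of rational specialisations *)

Section Positivity.
Variables (T : finType) (mut : pred T).

(* At most one coordinate vanishes, and it is frozen: it cannot kill both monomials
   of an exchange relation. *)
Definition almost_pos (v : T -> rat) :=
  (forall i, mut i -> 0 < v i) /\ exists k, 0 <= v k /\ forall i, i != k -> 0 < v i.

Lemma exch_pos v b : almost_pos v -> 0 < exch v b.
Proof.
case=> _ [k [hk hv]].
have pge i : 0 <= v i by have [->|/hv /ltW] := eqVneq i k.
have p1 : 0 <= \prod_(i | 0 < b i) v i ^+ `|b i|%N by apply: prodr_ge0 => i _; exact: exprn_ge0.
have p2 : 0 <= \prod_(i | b i < 0) v i ^+ `|b i|%N by apply: prodr_ge0 => i _; exact: exprn_ge0.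
have [bk|bk] := lerP 0 (b k).
  apply: ltr_wpDl => //; apply: prodr_gt0 => i bi; apply: exprn_gt0; apply: hv.
  by apply: contraTneq bi => ->; rewrite -leNgt.
apply: ltr_pwDl => //; apply: prodr_gt0 => i bi; apply: exprn_gt0; apply: hv.
by apply: contraTneq bi => ->; rewrite -leNgt ltW.
Qed.

Lemma almost_pos_gpath v B ks : all mut ks -> almost_pos v ->
  almost_pos (gpath (v, B) ks).1.
Proof.
elim: ks v B => //= k ks IH v B /andP [mk mks] hv; apply: IH => // {ks mks}.
have hp : 0 < gmutx k v B k.
  by rewrite /gmutx eqxx mulr_gt0 ?invr_gt0 ?exch_pos //; case: hv => h _; apply: h.
have hE i : i != k -> gmutx k v B i = v i by rewrite /gmutx => /negbTE ->.
case: hv => h1 [l [hl h2]]; split.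
  by move=> i mi; have [->//|ne] := eqVneq i k; rewrite hE //; apply: h1.
exists l; split; first by have [->|ne] := eqVneq l k; [exact: ltW | rewrite hE].
by move=> i il; have [->//|ne] := eqVneq i k; rewrite hE //; apply: h2.
Qed.

End Positivity.

(** * Seeds of independent variables, and denominators free of noninvertible variables *)

Section GoodSeeds.
Variables (K : idomainType) (E : fieldType) (h : {rmorphism K -> E}) (m : nat).
Variables (mut inv : pred 'I_m).
Hypothesis intK_inj : injective (fun z : int => z%:~R : K).
Implicit Types (y : 'I_m -> E) (S : gseed E 'I_m).

Let hZ : {rmorphism int -> E} := intr.
Let qZ : {rmorphism int -> rat} := intr.

Lemma mmap_intr y (q : {mpoly int[m]}) :
  mmap h y (map_mpoly (intr : {rmorphism int -> K}) q) = mmap hZ y q.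
Proof.
elim/mpoly_closed_ind: q => [c|i|p q e e'|p q e e'].
- by rewrite map_mpolyC !mmapC /= rmorph_int.
- by rewrite map_mpolyX !mmap_mX.
- by rewrite !rmorphD /= e e'.
- by rewrite !rmorphM /= e e'.
Qed.

Lemma algindep_int y : algindep h y -> algindep hZ y.
Proof.
move=> ai q; rewrite -mmap_intr => /ai e; apply/mpolyP => g.
apply: intK_inj; have := congr1 (fun p : {mpoly K[m]} => p@_g) e.
by rewrite mcoeff_map_mpoly /= !mcoeff0.
Qed.

(** The last condition follows from connectedness and m > 1. It excludes the constant exchange
    polynomial 2, and it persists under mutation. *)
Definition good S :=
  [/\ algindep h S.1, skewable mut S.2 & forall k, mut k -> exists i, S.2 i k != 0].

Lemma mmap_intr_neq0 y (v : 'I_m -> rat) (q : {mpoly int[m]}) : algindep h y ->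
  mmap qZ v q != 0 -> mmap hZ y q != 0.
Proof.
move=> /algindep_int ai; apply: contraNneq => /ai ->; by rewrite mmap0.
Qed.

Lemma good_spec S v ks r : algindep h S.1 -> almost_pos mut v -> all mut ks ->
  specialises (mmap hZ S.1) (mmap qZ v) ((gpath S ks).1 r) ((gpath (v, S.2) ks).1 r).
Proof.
case: S => x B /= ai hv mks; apply: (@spec_gpath _ _ _ _ _ _ _ mut) => //.
- by move=> q; apply: mmap_intr_neq0.
- by move=> i; have := spec_morph (mmap hZ x) (mmap qZ v) 'X_i; rewrite /= !mmap_mX.
- by move=> js mjs i mi; rewrite lt0r_neq0 //; case: (almost_pos_gpath B mjs hv) => + _; apply.
Qed.

Lemma gpath_frozen (F : fieldType) (S : gseed F 'I_m) ks i : all mut ks -> ~~ mut i ->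
  (gpath S ks).1 i = S.1 i.
Proof.
elim: ks S => //= k ks IH S /andP [mk mks] mi; rewrite IH //= /gmutx.
by case: eqP mi => // ->; rewrite mk.
Qed.

(** Setting all initial variables to 1 gives mutable cluster variables positive rational values;
    frozen variables are nonzero by independence. *)
Lemma good_nonvanishing S : good S -> nonvanishing mut S.
Proof.
case=> ai sk _ ks mks r.
have hv : almost_pos mut (fun=> 1) by split=> //; exists r.
have [mr|mr] := boolP (mut r); last by rewrite gpath_frozen //; apply: (algindep_neq0 _ ai).
apply: (spec_neq0 (fun q => mmap_intr_neq0 ai) (good_spec r ai hv mks)).
by rewrite lt0r_neq0 //; case: (almost_pos_gpath S.2 mks hv) => + _; apply.
Qed.

Lemma good_gmut S k : mut k -> good S -> good (gmut S k).
Proof.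
move=> mk gS; have nv := good_nonvanishing gS; case: S gS nv => x B [/= ai sk col] nv.
split=> /=; last 1 first.
(* Column [k] is negated. In another column the entry in row [k] only changes sign, and if it is 0
   the column is unchanged. *)
- move=> k' mk'; have [->|ne] := eqVneq k' k.
    by have [i hi] := col k mk; exists i; rewrite gmutBr oppr_eq0.
  have [e|hne] := eqVneq (B k k') 0; last by exists k; rewrite gmutBl oppr_eq0.
  have [i hi] := col k' mk'; exists i.
  have nik : i != k by apply: contraNneq hi => ->; rewrite e.
  by rewrite (@gmutB_sign _ _ _ _ _ 1) // e mulr0 /pos ltxx mulr0 !addr0.
- by apply: (algindep_mut mk sk) => //; apply: (nv [:: k]); rewrite /= mk.
- exact: skewable_mut.
Qed.

Lemma good_gpath S ks : all mut ks -> good S -> good (gpath S ks).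
Proof.
by elim: ks S => //= k ks IH S /andP [mk mks] gS; apply: IH => //; apply: good_gmut.
Qed.

Definition klaurent y : E -> Prop := rgen (fun f => (exists c, f = h c) \/
  (exists i, f = y i) \/ (exists i, inv i /\ f = (y i)^-1)).

Lemma klaurent_subring y : subring_pred (klaurent y).
Proof. exact: rgen_subring. Qed.

Lemma klaurent_var y i : klaurent y (y i).
Proof. by apply: rgen_base; right; left; exists i. Qed.

Lemma klaurent_inv y i : inv i -> klaurent y (y i)^-1.
Proof. by move=> hi; apply: rgen_base; right; right; exists i. Qed.

Lemma klaurent_const y c : klaurent y (h c).
Proof. by apply: rgen_base; left; exists c. Qed.

Lemma image_subring (R : comNzRingType) (phi : {rmorphism R -> E}) :
  subring_pred (fun f => exists q, f = phi q).
Proof.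
split=> [|a b [p ->] [q ->]|a [p ->]|a b [p ->] [q ->]].
- by exists 1; rewrite rmorph1.
- by exists (p + q); rewrite rmorphD.
- by exists (- p); rewrite rmorphN.
- by exists (p * q); rewrite rmorphM.
Qed.

Lemma zlaurent_clear y f : algindep hZ y -> zlaurent y f ->
  exists (q : {mpoly int[m]}) g, f * mmap1 y g = mmap hZ y q.
Proof.
move=> ai hf.
have [||s [i hi]|N [q e]] := @rgen_clear_denom E (fun f => exists q, f = mmap hZ y q) _
   (\prod_i y i) _ _ _ _ hf.
- exact: image_subring.
- by exists (\prod_i 'X_i); rewrite rmorph_prod; apply: eq_bigr => i _; rewrite /= mmap_mX.
- case: hi => ->; first by exists 0%N, 'X_i; rewrite mulr1 mmap_mX.
  exists 1%N, (\prod_(j | j != i) 'X_j); rewrite expr1 (bigD1 i) //= mulKf ?(algindep_neq0 _ ai) //.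
  by rewrite rmorph_prod; apply: eq_bigr => j _; rewrite /= mmap_mX.
exists q, [multinom N | i < m]; rewrite -e; congr (_ * _).
by rewrite /mmap1 -prodrXl; apply: eq_bigr => i _; rewrite mnmE.
Qed.

Lemma klaurent_clear y f : algindep h y -> klaurent y f ->
  exists (q : {mpoly K[m]}) (g : 'X_{1..m}), (forall i, ~~ inv i -> g i = 0%N) /\
    f * mmap1 y g = mmap h y q.
Proof.
move=> ai hf.
have [||s [[c ->]|[[i ->]|[i [ii ->]]]]|N [q e]] :=
   @rgen_clear_denom E (fun f => exists q, f = mmap h y q) _ (\prod_(i | inv i) y i) _ _ _ _ hf.
- exact: image_subring.
- by exists (\prod_(i | inv i) 'X_i); rewrite rmorph_prod; apply: eq_bigr => i _; rewrite /= mmap_mX.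
- by exists 0%N, c%:MP; rewrite mulr1 mmapC.
- by exists 0%N, 'X_i; rewrite mulr1 mmap_mX.
- exists 1%N, (\prod_(j | inv j && (j != i)) 'X_j).
  rewrite expr1 (bigD1 i) //= mulKf ?(algindep_neq0 _ ai) //.
  by rewrite rmorph_prod; apply: eq_bigr => j _; rewrite /= mmap_mX.
exists q, [multinom (if inv i then N else 0%N) | i < m]; split.
  by move=> i /negbTE hi; rewrite mnmE hi.
rewrite -e; congr (_ * _).
rewrite /mmap1 -prodrXl [RHS]big_mkcond; apply: eq_bigr => i _; rewrite mnmE.
by case: ifP.
Qed.

(* A cluster variable is a unit at the place [x_i = 0] of a frozen [x_i], so [x_i]
   cannot occur in its reduced denominator. *)
Lemma laurent_frozen S ks r : good S -> (forall i, mut i -> inv i) -> all mut ks ->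
  exists (q : {mpoly int[m]}) (g : 'X_{1..m}), (forall i, ~~ inv i -> g i = 0%N) /\
    (gpath S ks).1 r * mmap1 S.1 g = mmap hZ S.1 q.
Proof.
move=> gS mi_inv mks; have nv := good_nonvanishing gS; have [ai sk _] := gS.
have aiZ := algindep_int ai; set f := (gpath S ks).1 r.
have [q [g e]] : exists (q : {mpoly int[m]}) g, f * mmap1 S.1 g = mmap hZ S.1 q.
  apply: zlaurent_clear => //; rewrite /f; case: (S) sk nv => x B sk nv.
  exact: (laurent_phenomenon sk nv mks).
have [N] := ubnP (mdeg g); elim: N g q e => // N IH g q e hN.
have [hg|] := boolP [forall i, ~~ inv i ==> (g i == 0%N)].
  by exists q, g; split=> // i ii; apply/eqP; have /forallP /(_ i) /implyP := hg; apply.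
rewrite negb_forall => /existsP [i]; rewrite negb_imply => /andP [ii gi].
have mi : ~~ mut i by apply: contraNN ii => /mi_inv.
pose v j : rat := if j == i then 0 else 1.
have hv : almost_pos mut v.
  split; first by move=> j mj; rewrite /v; case: eqP mi => // <-; rewrite mj.
  by exists i; rewrite /v eqxx; split=> // j /negbTE ->.
have [P [Q [nQ ef _]]] := good_spec r ai hv mks.
have eg : g = (U_(i) + (g - U_(i)))%MM by rewrite addmC submK // lep1mP.
have mm g' : mmap1 S.1 (U_(i) + g')%MM = S.1 i * mmap1 S.1 g'.
  by rewrite -!(mmapX S.1 hZ) mpolyXD rmorphM /= mmap_mX.
have eX : q * Q = 'X_i * (P * 'X_[g - U_(i)]).
  apply: (algindep_inj aiZ); rewrite !rmorphM /= -e -/f /f ef mulrAC divfK.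
    by rewrite {1}eg mm mmap_mX mmapX mulrCA.
  exact: (mmap_intr_neq0 ai nQ).
(* X_i cannot divide [Q], which is nonzero at the point with x_i = 0; hence it divides [q], and one
   factor x_i of the denominator cancels. *)
case: (mX_prime eX) => [[q' eq]|[Q' eQ]]; last first.
  by move: nQ; rewrite eQ rmorphM /= mmap_mX /v eqxx mul0r eqxx.
apply: (IH (g - U_(i))%MM q').
  apply: (mulfI (algindep_neq0 i aiZ)).
  rewrite -{2}(mmap_mX hZ S.1 i) -rmorphM /= -eq -e mulrCA; congr (_ * _).
  by rewrite {2}eg mm.
by move: hN; rewrite {1}eg mdegD mdeg1; lia.
Qed.

Lemma laurent_klaurent S ks r : good S -> (forall i, mut i -> inv i) -> all mut ks ->
  klaurent S.1 ((gpath S ks).1 r).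
Proof.
move=> gS hinv mks; have [q [g [hg e]]] := laurent_frozen r gS hinv mks.
have [ai _ _] := gS; have hk := klaurent_subring S.1.
have hq : klaurent S.1 (mmap hZ S.1 q).
  elim/mpoly_closed_ind: (q) => [c|i|p p' e1 e2|p p' e1 e2].
  - by rewrite mmapC; apply: sr_int.
  - by rewrite mmap_mX; apply: klaurent_var.
  - by rewrite rmorphD; apply: srD.
  - by rewrite rmorphM; apply: srM.
have ng : mmap1 S.1 g != 0.
  by apply/prodf_neq0 => i _; rewrite expf_neq0 // (algindep_neq0 _ ai).
rewrite -[X in klaurent _ X](mulfK ng) e; apply: srM => //.
rewrite /mmap1 -prodfV; apply: sr_prod => // i _.
have [ii|/hg ->] := boolP (inv i); last by rewrite invr1; exact: sr1.
by rewrite -exprVn; apply: srX => //; apply: klaurent_inv.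
Qed.

End GoodSeeds.

(** * Units and irreducibility via Laurent expansions in neighbouring clusters *)

Section Units.
Variables (K : idomainType) (E : fieldType) (h : {rmorphism K -> E}) (m : nat).
Variables (mut inv : pred 'I_m).
Hypothesis intK_inj : injective (fun z : int => z%:~R : K).
Implicit Types (y : 'I_m -> E) (S : gseed E 'I_m) (a b : 'I_m -> int).

Lemma mmapZX y d (g : 'X_{1..m}) : mmap h y (d *: 'X_[g]) = h d * mmap1 y g.
Proof. by rewrite mmapZ mmapX. Qed.

Lemma mmap1D y (g g' : 'X_{1..m}) : mmap1 y (g + g')%MM = mmap1 y g * mmap1 y g'.
Proof. by rewrite -!(mmapX y h) mpolyXD rmorphM. Qed.

Lemma lmon_pos_neg y a : (forall i, y i != 0) ->
  lmon y a * mmap1 y (neg_mnm a) = mmap1 y (pos_mnm a).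
Proof.
move=> ny; rewrite !mmap1_lmon -lmonD //; apply: eq_lmon => i; rewrite !mnmE.
by case: ltgtP => h1; lia.
Qed.

(** Clearing denominators leaves a factorisation of a monomial, whose factors are monomials.
    Denominators avoid the noninvertible variables, so exponents there stay nonnegative. *)
Lemma klaurent_unit y u v (g : 'X_{1..m}) : algindep h y ->
  klaurent h inv y u -> klaurent h inv y v -> u * v = mmap1 y g ->
  exists d d' a b, [/\ d * d' = 1, u = h d * lmon y a, v = h d' * lmon y b,
    forall i, a i + b i = (g i)%:Z & forall i, ~~ inv i -> 0 <= a i /\ 0 <= b i].
Proof.
move=> ai /(klaurent_clear ai) [q1 [g1 [h1 e1]]] /(klaurent_clear ai) [q2 [g2 [h2 e2]]] e.
have ny i : y i != 0 := algindep_neq0 i ai.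
have eq12 : q1 * q2 = 1 *: 'X_[g + (g1 + g2)].
  apply: (algindep_inj ai); rewrite rmorphM /= -e1 -e2 mmapZX rmorph1 mul1r.
  by rewrite !mmap1D -e mulrACA.
have [d [d' [gp [gq [f1 f2 f3 f4]]]]] := monomial_factor (oner_neq0 _) eq12.
exists d, d', (fun i => (gp i)%:Z - (g1 i)%:Z), (fun i => (gq i)%:Z - (g2 i)%:Z); split=> //.
- apply: (mulIf (x := mmap1 y g1)); first by rewrite mmap1_lmon lmon_neq0.
  rewrite e1 f1 mmapZX -mulrA; congr (_ * _); rewrite !mmap1_lmon -lmonD //.
  by apply: eq_lmon => i; rewrite subrK.
- apply: (mulIf (x := mmap1 y g2)); first by rewrite mmap1_lmon lmon_neq0.
  rewrite e2 f2 mmapZX -mulrA; congr (_ * _); rewrite !mmap1_lmon -lmonD //.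
  by apply: eq_lmon => i; rewrite subrK.
- by move=> i; have /mnmP /(_ i) := f4; rewrite !mnmDE; lia.
- by move=> i ii; rewrite h1 // h2 //; split; lia.
Qed.

Lemma lmon_inj y a b d d' : algindep h y -> d != 0 ->
  h d * lmon y a = h d' * lmon y b -> d = d' /\ a =1 b.
Proof.
move=> ai nd e; have ny i : y i != 0 := algindep_neq0 i ai.
pose c i := a i - b i.
have ec : lmon y a = lmon y c * lmon y b.
  by rewrite -lmonD //; apply: eq_lmon => i; rewrite subrK.
have e1 : h d * lmon y c = h d'.
  by apply: (mulIf (lmon_neq0 b ny)); rewrite -mulrA -ec.
have e2 : d *: 'X_[pos_mnm c] = d' *: 'X_[neg_mnm c] :> {mpoly K[m]}.
  by apply: (algindep_inj ai); rewrite !mmapZX -lmon_pos_neg // mulrA e1.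
have e3 : neg_mnm c = pos_mnm c.
  apply/eqP; have := congr1 (fun p : {mpoly K[m]} => p@_(pos_mnm c)) e2.
  rewrite !mcoeffZ !mcoeffX eqxx mulr1; case: eqP => // _; rewrite mulr0 => d0.
  by rewrite d0 eqxx in nd.
split.
  have := congr1 (fun p : {mpoly K[m]} => p@_(pos_mnm c)) e2.
  by rewrite !mcoeffZ !mcoeffX e3 eqxx !mulr1.
move=> i; have /mnmP /(_ i) := e3; rewrite !mnmE /c.
by case: ltgtP => h1; lia.
Qed.

(** A negative exponent at [k] would put a power of the exchange polynomial into the denominator
    over the neighbouring cluster. It would then divide a monomial, yet it is not itself a
    monomial. *)
Lemma gmut_no_pole S k d a : good h mut S -> mut k -> d != 0 ->
  klaurent h inv (gmut S k).1 (h d * lmon S.1 a) -> 0 <= a k.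
Proof.
move=> gS mk nd kl; rewrite leNgt; apply/negP => ak.
have gS' := good_gmut intK_inj mk gS; have [ai sk col] := gS; have [ai' _ _] := gS'.
set y := S.1 in ai kl *; set y' := (gmut S k).1 in ai' kl *; set b := (fun i => S.2 i k).
have ny i : y i != 0 := algindep_neq0 i ai.
have ny' i : y' i != 0 := algindep_neq0 i ai'.
have yE i : i != k -> y' i = y i by rewrite /y' /= /gmutx => /negbTE ->.
have bk : b k = 0 by apply: skewable_diag sk mk.
have ex : y' k * y k = mmap h y' (exch_poly K b).
  rewrite exch_polyE (@exch_eq _ _ y' y) => [|i bi].
    by rewrite {1}/y' /= /gmutx eqxx -/y mulrC mulVKf.
  by apply: yE; apply: contraNneq bi => ->; rewrite bk.
have [q [g [_ e]]] := klaurent_clear ai' kl.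
(* As y_k is the exchange polynomial divided by y'_k, the exponent at [k] changes sign. *)
pose a' i := if i == k then - a k else a i.
have [N aN] : exists N : nat, - a k = (N.+1)%:Z by exists (absz (a k)).-1; lia.
have ea : lmon y a * (mmap h y' (exch_poly K b)) ^+ N.+1 = lmon y' a'.
  rewrite -ex exprMn (lmonD1 k) [lmon y' a'](lmonD1 k) /a' eqxx aN -exprnP.
  rewrite [X in _ = _ * X](eq_bigr (fun i => y i ^ a i)); last first.
    by move=> i ik; rewrite yE // (negbTE ik).
  have -> : y k ^ a k = (y k ^+ N.+1)^-1 by rewrite -[a k]opprK aN -invr_expz -exprnP.
  have nN : y k ^+ N.+1 != 0 by rewrite expf_neq0.
  by field.
have eq : exch_poly K b * (exch_poly K b ^+ N * (q * 'X_[neg_mnm a'])) = d *: 'X_[pos_mnm a' + g].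
  apply: (algindep_inj ai'); rewrite mulrA -exprS !rmorphM rmorphXn /= -e mmapX mmapZX mmap1D.
  rewrite -lmon_pos_neg // -ea; ring.
have [d1 [d2 [g1 [g2 [f1 _ _ _]]]]] := monomial_factor nd eq.
by have := exch_poly_not_monomial d1 g1 (col k mk); rewrite -/b f1 eqxx.
Qed.

(** The shape that every unit of the cluster algebra will be shown to have; [d'] witnesses that [d]
    is a unit of [K]. *)
Definition frozen_unit y u := exists d d' a, [/\ d * d' = 1, u = h d * lmon y a
  & forall i, mut i || ~~ inv i -> a i = 0].

Lemma frozen_unit_in y (M : E -> Prop) u : subring_pred M -> (forall c, M (h c)) ->
  (forall i, ~~ mut i && inv i -> bi_in M (y i)) -> frozen_unit y u -> M u /\ M u^-1.
Proof.
move=> hM Mc My [d [d' [a [dd -> ha]]]].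
have [M1 M2] : bi_in M (lmon y a).
  apply: bi_in_lmon => // i; have [hi|] := boolP (mut i || ~~ inv i); first by left; apply: ha.
  by rewrite negb_or negbK => /My; right.
split; first exact: srM.
rewrite invfM; apply: srM => //.
suff -> : (h d)^-1 = h d' by [].
have dn : h d * h d' = 1 by rewrite -rmorphM dd rmorph1.
have nz : h d != 0 by apply: contraTneq (oner_neq0 E) => e; rewrite -dn e mul0r negbK.
by apply: (mulfI nz); rewrite mulfV.
Qed.

Variables (S : gseed E 'I_m) (A : E -> Prop).
Hypotheses (gS : good h mut S) (A0 : forall f, A f -> klaurent h inv S.1 f).
Hypothesis A1 : forall k f, mut k -> A f -> klaurent h inv (gmut S k).1 f.

(** Each neighbouring Laurent ring forbids a negative exponent at its mutated index; at
    noninvertible frozen indices the ring of [S] itself does. *)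
Lemma factor_exponents u v (g : 'X_{1..m}) : A u -> A v -> u * v = mmap1 S.1 g ->
  exists d d' a b, [/\ d * d' = 1, u = h d * lmon S.1 a, v = h d' * lmon S.1 b,
    forall i, a i + b i = (g i)%:Z & forall i, mut i || ~~ inv i -> 0 <= a i /\ 0 <= b i].
Proof.
move=> Au Av e; have [ai _ _] := gS.
have [d [d' [a [b [h1 h2 h3 h4 h5]]]]] := klaurent_unit ai (A0 Au) (A0 Av) e.
have nd : d != 0 by apply: contraTneq (oner_neq0 K) => d0; rewrite -h1 d0 mul0r negbK.
have nd' : d' != 0 by apply: contraTneq (oner_neq0 K) => d0; rewrite -h1 d0 mulr0 negbK.
exists d, d', a, b; split=> // i /orP [mi|]; last exact: h5.
split; first by apply: (gmut_no_pole gS mi nd); rewrite -h2; apply: A1.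
by apply: (gmut_no_pole gS mi nd'); rewrite -h3; apply: A1.
Qed.

Lemma unit_frozen u v : A u -> A v -> u * v = 1 -> frozen_unit S.1 u.
Proof.
move=> Au Av e.
have e' : u * v = mmap1 S.1 0%MM by rewrite mmap11.
have [d [d' [a [b [h1 h2 h3 h4 h5]]]]] := factor_exponents Au Av e'.
exists d, d', a; split=> // i hi; have := h4 i; have [] := h5 i hi; rewrite mnm0E; lia.
Qed.

Lemma var_not_unit k v : mut k -> A (S.1 k) -> A v -> S.1 k * v <> 1.
Proof.
move=> mk Ak Av /(unit_frozen Ak Av) [d [d' [a [dd e ha]]]]; have [ai _ _] := gS.
have e' : h 1 * lmon S.1 (fun i => (i == k)%:Z) = h d * lmon S.1 a.
  rewrite -e rmorph1 mul1r (lmonD1 k) eqxx expr1z big1 ?mulr1 // => i /negbTE ->.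
  by rewrite expr0z.
have [_ /(_ k)] := lmon_inj ai (oner_neq0 _) e'.
by rewrite eqxx ha // mk.
Qed.

(** The nonnegative exponents at [k] add up to 1, so one factor has exponent 0 there, and then at
    all mutable and noninvertible indices. *)
Lemma var_irreducible k u v : mut k -> A u -> A v -> S.1 k = u * v ->
  frozen_unit S.1 u \/ frozen_unit S.1 v.
Proof.
move=> mk Au Av e.
have e' : u * v = mmap1 S.1 U_(k)%MM by rewrite mmap1U.
have [d [d' [a [b [h1 h2 h3 h4 h5]]]]] := factor_exponents Au Av e'.
have [ak|bk] : a k = 0 \/ b k = 0.
  by have [] := h5 k; rewrite ?mk //; have := h4 k; rewrite mnm1E eqxx; lia.
- left; exists d, d', a; split=> // i hi; have [->//|ne] := eqVneq i k.
  by have := h4 i; have [] := h5 i hi; rewrite mnm1E eq_sym (negbTE ne); lia.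
- right; exists d', d, b; split=> //; first by rewrite mulrC.
  move=> i hi; have [->//|ne] := eqVneq i k.
  by have := h4 i; have [] := h5 i hi; rewrite mnm1E eq_sym (negbTE ne); lia.
Qed.

End Units.

(** * Associated cluster variables are equal *)

Section Associates.
Variables (K : idomainType) (E : fieldType) (h : {rmorphism K -> E}) (m : nat).
Variables (mut inv : pred 'I_m).
Hypothesis intK_inj : injective (fun z : int => z%:~R : K).
Hypothesis mut_inv : forall i, mut i -> inv i.
Implicit Types (S : gseed E 'I_m).

Let hZ : {rmorphism int -> E} := intr.
Let qZ : {rmorphism int -> rat} := intr.
Let kZ : {rmorphism int -> K} := intr.

Lemma mmap_int_point (R : comNzRingType) (w : 'I_m -> int) (q : {mpoly int[m]}) :
  mmap (intr : {rmorphism int -> R}) (fun i => (w i)%:~R) q = (mmap idfun w q)%:~R.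
Proof.
elim/mpoly_closed_ind: q => [c|i|p q e e'|p q e e'].
- by rewrite !mmapC.
- by rewrite !mmapX !mmap1U.
- by rewrite !mmapD e e' rmorphD.
- by rewrite !rmorphM /= e e'.
Qed.

Lemma mmap_int_point_neq0 (w : 'I_m -> int) (q : {mpoly int[m]}) :
  mmap qZ (fun i => (w i)%:~R) q != 0 -> mmap kZ (fun i => (w i)%:~R) q != 0.
Proof.
rewrite !mmap_int_point intr_eq0; apply: contraNneq => e.
by apply/eqP/intK_inj; rewrite e.
Qed.

Lemma meval_map_intr (v : 'I_m -> K) (q : {mpoly int[m]}) :
  mmap idfun v (map_mpoly kZ q) = mmap kZ v q.
Proof.
elim/mpoly_closed_ind: q => [c|i|p q e e'|p q e e'].
- by rewrite map_mpolyC !mmapC.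
- by rewrite map_mpolyX !mmapX.
- by rewrite !rmorphD /= e e'.
- by rewrite !rmorphM /= e e'.
Qed.

Lemma good_spec_pos S (w : 'I_m -> int) ks i :
  good h mut S -> almost_pos mut (fun i => (w i)%:~R) -> all mut ks -> mut i ->
  exists P Q : {mpoly int[m]}, let ev := mmap qZ (fun i => (w i)%:~R) in
    [/\ (gpath S ks).1 i = mmap hZ S.1 P / mmap hZ S.1 Q, mmap hZ S.1 Q != 0
      & [/\ ev P != 0, ev Q != 0 & 0 < ev P / ev Q]].
Proof.
move=> [ai _ _] hv mks mi.
have [P [Q [nQ e1 e2]]] := good_spec intK_inj i ai hv mks.
exists P, Q => /=; rewrite -e2.
have hp : 0 < (gpath ((fun i => (w i)%:~R : rat), S.2) ks).1 i.
  by case: (almost_pos_gpath S.2 mks hv) => + _; apply.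
split=> //; first exact: (mmap_intr_neq0 intK_inj ai nQ).
split=> //; move: hp; rewrite e2; apply: contraTneq => /= ->.
by rewrite mul0r ltxx.
Qed.

(** The Laurent expansion has integer coefficients and a monomial denominator, so [d] reappears as a
    coefficient of an integer polynomial. *)
Lemma scalar_int S ks i j d : good h mut S -> all mut ks ->
  (gpath S ks).1 i = h d * S.1 j -> exists z : int, d = z%:~R.
Proof.
move=> gS mks e; have [ai _ _] := gS.
have [q [g [_ eq]]] := laurent_frozen intK_inj i gS mut_inv mks.
have e' : d *: 'X_[U_(j) + g] = map_mpoly kZ q.
  by apply: (algindep_inj ai); rewrite mmap_intr mmapZX (mmap1D h) mmap1U mulrA -e eq.
exists (q@_(U_(j) + g)).
have := congr1 (fun p : {mpoly K[m]} => p@_(U_(j) + g)) e'.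
by rewrite mcoeffZ mcoeffX eqxx mulr1 mcoeff_map_mpoly.
Qed.

(** Where one frozen variable is 0 and all other variables are 1, both cluster variables have
    nonzero values; hence that frozen variable has exponent 0 in [u]. *)
Lemma frozen_unit_scalar S ks1 ks2 i j u : good h mut S -> all mut ks1 -> all mut ks2 ->
  mut i -> mut j -> frozen_unit h mut inv S.1 u ->
  (gpath S ks1).1 i = u * (gpath S ks2).1 j -> exists d d', d * d' = 1 /\ u = h d.
Proof.
move=> gS mk1 mk2 mi mj [d [d' [a [dd -> ha]]]] e; exists d, d'; split=> //.
have nd : d != 0 by apply: contraTneq (oner_neq0 K) => d0; rewrite -dd d0 mul0r negbK.
have [ai _ _] := gS; have nx l : S.1 l != 0 := algindep_neq0 l ai.
suff a0 l : a l = 0 by rewrite /lmon big1 ?mulr1 // => l _; rewrite a0 expr0z.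
have [ml|ml] := boolP (mut l); first by apply: ha; rewrite ml.
pose w k : int := if k == l then 0 else 1.
have hv : almost_pos mut (fun k => (w k)%:~R).
  split; first by move=> k mk; rewrite /w; case: eqP ml => // <-; rewrite mk.
  by exists l; rewrite /w eqxx; split=> // k /negbTE ->.
have [P [Q [eP nQ' [nP nQ _]]]] := good_spec_pos gS hv mk1 mi.
have [R [T [eR nT' [nR nT _]]]] := good_spec_pos gS hv mk2 mj.
have eqX : map_mpoly kZ (P * T) * 'X_[neg_mnm a] =
           (d *: 'X_[pos_mnm a]) * map_mpoly kZ (R * Q).
  apply: (algindep_inj ai).
  rewrite [LHS]rmorphM [RHS]rmorphM /= !mmap_intr !rmorphM /= mmapX mmapZX -lmon_pos_neg //.
  move: e; rewrite eP eR => e.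
  have -> : mmap hZ S.1 P = h d * lmon S.1 a * (mmap hZ S.1 R / mmap hZ S.1 T) * mmap hZ S.1 Q.
    by rewrite -e divfK.
  by field.
pose v k : K := (w k)%:~R.
have neK q : mmap qZ (fun k => (w k)%:~R) q != 0 -> mmap kZ v q != 0.
  exact: mmap_int_point_neq0.
have := congr1 (mmap idfun v) eqX.
rewrite [X in X = _]rmorphM [X in _ = X]rmorphM /= !meval_map_intr mmapZ !mmapX !rmorphM /=.
have v1 (g : 'X_{1..m}) : g l = 0%N -> mmap1 v g = 1.
  move=> gl; rewrite /mmap1 big1 // => k _; rewrite /v /w.
  by case: eqP => [->|_]; rewrite ?gl ?expr0 // expr1n.
have v0 (g : 'X_{1..m}) : g l != 0%N -> mmap1 v g = 0.
  move=> gl; rewrite /mmap1 (bigD1 l) //= /v /w eqxx -[0%:~R]/(0 : K) expr0n (negbTE gl) mul0r //.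
(* A nonzero exponent at [l] would make exactly one side of the evaluated identity vanish. *)
case: (ltgtP (a l) 0) => // al /eqP.
- rewrite v0 ?mnmE ?al; last by rewrite absz_eq0 lt_eqF.
  rewrite v1 ?mnmE; last by rewrite ltNge ltW.
  rewrite mulr0 mulr1 eq_sym => /eqP/eqP.
  by rewrite !mulf_eq0 (negbTE nd) (negbTE (neK _ nR)) (negbTE (neK _ nQ)).
- rewrite v1 ?mnmE; last by rewrite ltNge ltW.
  rewrite v0 ?mnmE ?al; last by rewrite absz_eq0 gt_eqF.
  by rewrite mulr0 mul0r mulr1 mulf_eq0 (negbTE (neK _ nP)) (negbTE (neK _ nT)).
Qed.

(** Expanding each variable in the cluster of the other shows that the scalar and its inverse are
    integers, hence 1 or -1; positivity at the point with all coordinates 1 excludes -1. *)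
Lemma assoc_var_eq S ks1 ks2 i j u : good h mut S -> all mut ks1 -> all mut ks2 ->
  mut i -> mut j -> frozen_unit h mut inv S.1 u ->
  (gpath S ks1).1 i = u * (gpath S ks2).1 j -> (gpath S ks1).1 i = (gpath S ks2).1 j.
Proof.
move=> gS mk1 mk2 mi mj fu e.
have [d [d' [dd eu]]] := frozen_unit_scalar gS mk1 mk2 mi mj fu e.
have nv := good_nonvanishing intK_inj gS; have [ai sk _] := gS.
move: e; rewrite {}eu => {fu u} e.
have trans ks ks' : all mut ks -> gpath (gpath S ks) (rev ks ++ ks') = gpath S ks'.
  by move=> mk; rewrite {1}/gpath foldl_cat -/(gpath _ _) -/(gpath _ _) (gpath_rev mk sk nv).
have mtr ks ks' : all mut ks -> all mut ks' -> all mut (rev ks ++ ks').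
  by rewrite all_cat all_rev => -> ->.
have [z ez] : exists z : int, d = z%:~R.
  apply: (@scalar_int (gpath S ks2) (rev ks2 ++ ks1) i j) => //; first exact: good_gpath.
    exact: mtr.
  by rewrite trans.
have e' : (gpath S ks2).1 j = h d' * (gpath S ks1).1 i.
  by rewrite e mulrA -rmorphM [d' * d]mulrC dd rmorph1 mul1r.
have [z' ez'] : exists z : int, d' = z%:~R.
  apply: (@scalar_int (gpath S ks1) (rev ks1 ++ ks2) j i) => //; first exact: good_gpath.
    exact: mtr.
  by rewrite trans.
have zz : z * z' = 1 by apply: intK_inj; rewrite rmorphM /= -ez -ez' dd.
have [z1|z1] : z = 1 \/ z = -1.
  have /eqP : (absz z * absz z' = 1)%N by rewrite -abszM zz.
  by rewrite muln_eq1 => /andP [/eqP hz _]; lia.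
  by rewrite e ez z1 !rmorph1 mul1r.
have hv : almost_pos mut (fun k => (1 : int)%:~R) by split=> //; exists i.
have [P [Q [eP nQ' [nP nQ hPQ]]]] := good_spec_pos gS hv mk1 mi.
have [R [T [eR nT' [nR nT hRT]]]] := good_spec_pos gS hv mk2 mj.
have eq : P * T = - (R * Q).
  apply: (algindep_inj (algindep_int intK_inj ai)).
  rewrite rmorphN !rmorphM /=; move: e; rewrite eP eR ez z1 !rmorphN1 => e.
  have -> : mmap hZ S.1 P = -1 * (mmap hZ S.1 R / mmap hZ S.1 T) * mmap hZ S.1 Q.
    by rewrite -e divfK.
  by field.
have := congr1 (mmap qZ (fun=> (1 : int)%:~R)) eq.
rewrite rmorphN !rmorphM /= => e1.
have e2 : mmap qZ (fun=> (1 : int)%:~R) P / mmap qZ (fun=> (1 : int)%:~R) Q =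
        - (mmap qZ (fun=> (1 : int)%:~R) R / mmap qZ (fun=> (1 : int)%:~R) T).
  apply: (mulIf (x := mmap qZ (fun=> (1 : int)%:~R) Q * mmap qZ (fun=> (1 : int)%:~R) T)).
    by rewrite mulf_neq0.
  by rewrite mulrA divfK // e1; field.
by move: hPQ; rewrite e2 oppr_gt0 ltNge ltW.
Qed.

End Associates.

(** * Irreducibles and primes in factorial subrings *)

Section FactorialSubrings.
Variables (K : idomainType) (m : nat).
Local Notation FF := (F K m).
Implicit Types (V : FF -> Prop) (a b c : FF).

Lemma irred_unit_mul V a d : subring_pred V -> irredIn V a -> unitIn V d ->
  irredIn V (a * d).
Proof.
move=> hV [Va [na [nu irr]]] [Vd [d' [Vd' dd']]].
have nd : d != 0 by apply: contraTneq (oner_neq0 FF) => e; rewrite -dd' e mul0r negbK.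
split; first exact: srM.
split; first by move/eqP; rewrite mulf_eq0 (negbTE nd) orbF => /eqP.
split.
  case=> _ [b [Vb e]]; apply: nu; split=> //; exists (d * b); split; first exact: srM.
  by rewrite mulrA.
move=> b c Vb Vc e.
have e' : a = b * (c * d') by rewrite mulrA -e -mulrA dd' mulr1.
case: (irr b (c * d') Vb _ e') => [|ub|[_ [c' [Vc' ec]]]]; [exact: srM| by left |right].
split=> //; exists (d' * c'); split; first exact: srM.
by rewrite mulrA.
Qed.

Lemma mem_dvd_prod V a q (s : seq FF) : subring_pred V -> (forall q, q \in s -> V q) ->
  q \in s -> dvdIn V a q -> dvdIn V a (\prod_(r <- s) r).
Proof.
move=> hV Vs qs [c [Vc e]]; exists (c * \prod_(r <- rem q s) r); split.
  apply: srM => //; rewrite big_seq; apply: (big_ind V); [exact: sr1|exact: srM|].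
  by move=> r /mem_rem; apply: Vs.
by rewrite (perm_big _ (perm_to_rem qs)) big_cons /= e mulrA.
Qed.

(** Both sides of b c = a d are factored into irreducibles; by uniqueness [a] is associated with a
    factor of [b] or of [c]. *)
Lemma factorial_irred_prime V a : subring_pred V -> is_factorial V ->
  irredIn V a -> primeIn V a.
Proof.
move=> hV [_ [ex un]] ia; have [Va [na [nu irr]]] := ia.
have V0 := sr0 hV; have V1 := sr1 hV.
split=> //; split=> //; split=> // b c Vb Vc [d [Vd e]].
have dvd0 : dvdIn V a 0 by exists 0; rewrite mulr0.
have [-> |nb] := eqVneq b 0; first by left.
have [-> |nc] := eqVneq c 0; first by right.
have nd : d != 0.
  by apply: contraTneq (mulf_neq0 nb nc) => d0; rewrite e d0 mulr0 negbK eqxx.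
have unit_case b' c' : V b' -> V c' -> b' * c' = a * d -> unitIn V b' -> dvdIn V a c'.
  move=> Vb' Vc' e' [_ [b1 [Vb1 eb]]]; exists (d * b1); split; first exact: srM.
  by rewrite mulrA -e' mulrAC eb mul1r.
have [ub|nub] := classic (unitIn V b); first by right; apply: (unit_case b c).
have [uc|nuc] := classic (unitIn V c).
  by left; apply: (unit_case c b) => //; rewrite mulrC.
have [sb [isb eb]] := ex b Vb (elimN eqP nb) nub.
have [sc [isc ec]] := ex c Vc (elimN eqP nc) nuc.
(* A unit [d] has no factorisation to use, so it is absorbed into [a] by taking [e1] to be [d];
   otherwise [e1] is 1. *)
have [e1 [s [ue1 is1 es]]] : exists e1 s, [/\ unitIn V e1,
    forall q, q \in a * e1 :: s -> irredIn V q & \prod_(q <- a * e1 :: s) q = b * c].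
  have [ud|nud] := classic (unitIn V d).
    exists d, [::]; split=> //; last by rewrite big_seq1.
    by move=> q; rewrite inE => /eqP ->; apply: irred_unit_mul.
  have [sd [isd ed]] := ex d Vd (elimN eqP nd) nud.
  exists 1, sd; split.
  - by split=> //; exists 1; rewrite mulr1.
  - by move=> q; rewrite inE mulr1 => /orP [/eqP ->|/isd].
  - by rewrite big_cons mulr1 -ed.
have ist q : q \in sb ++ sc -> irredIn V q by rewrite mem_cat => /orP [/isb|/isc].
have ep : \prod_(q <- a * e1 :: s) q = \prod_(q <- sb ++ sc) q by rewrite es big_cat eb ec.
have [t' [pt [st /(_ 0%N isT) [u [[Vu [u' [Vu' uu']]] eu]]]]] := un _ _ is1 ist ep.
case: t' pt st eu => // q t' pt _ /= eu.
have hq : q \in sb ++ sc by rewrite (perm_mem pt) inE eqxx.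
have dq : dvdIn V a q.
  case: ue1 => Ve1 _; exists (e1 * u'); split; first exact: srM.
  by rewrite mulrA eu mulrAC uu' mul1r.
move: hq; rewrite mem_cat => /orP [hq|hq]; [left; rewrite eb|right; rewrite ec];
  apply: (mem_dvd_prod hV _ hq dq) => r hr.
  by case: (isb r hr).
by case: (isc r hr).
Qed.

(* [g y] and [g w^N] in [V] force [y | (g y) w^N], hence [y | g y] when [y] is prime
   and does not divide [w]. *)
Lemma cancel_primes V (I J : finType) (P : pred I) (Q : pred J) (y : I -> FF) (z : J -> FF) f M N :
  subring_pred V -> (forall i, P i -> primeIn V (y i)) -> (forall j, Q j -> V (z j)) ->
  (forall i j, P i -> Q j -> ~ dvdIn V (y i) (z j)) ->
  V (f * (\prod_(i | P i) y i) ^+ M) -> V (f * (\prod_(j | Q j) z j) ^+ N) -> V f.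
Proof.
move=> hV py Vz ndvd; set w := \prod_(j | Q j) z j.
pose canc e := V e /\ forall g, V (g * e) -> (exists N, V (g * w ^+ N)) -> V g.
have canc1 : canc 1 by split; [exact: sr1 | move=> g; rewrite mulr1].
have cancM e e' : canc e -> canc e' -> canc (e * e').
  move=> [Ve ce] [Ve' ce']; split; first exact: srM.
  move=> g Vg [k Vk]; apply: ce; last by exists k.
  apply: ce'; first by rewrite -mulrA.
  by exists k; rewrite mulrAC; apply: srM.
have cancy i : P i -> canc (y i).
  move=> Pi; have [Vy [ny [nuy pr]]] := py i Pi; split=> // g Vg [k Vk].
  pose ND e := V e /\ ~ dvdIn V (y i) e.
  have ND1 : ND 1 by split; [exact: sr1 | case=> c [Vc e]; apply: nuy; split=> //; exists c].
  have NDM e e' : ND e -> ND e' -> ND (e * e').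
    move=> [Ve ne] [Ve' ne']; split; first exact: srM.
    by case/(pr _ _ Ve Ve').
  have [Vw nw] : ND (w ^+ k).
    have NDw : ND w by apply: (big_ind ND) => // j Qj; split; [exact: Vz | exact: ndvd].
    by elim: k {Vk} => [|k IH]; [rewrite expr0 | rewrite exprS; exact: NDM].
  have : dvdIn V (y i) (g * y i * w ^+ k) by exists (g * w ^+ k); split=> //; rewrite -mulrA mulrCA.
  case/(pr _ _ Vg Vw) => // -[c [Vc]]; rewrite mulrC => /mulfI.
  by move=> -> //; apply/eqP.
move=> h1 h2; have [_ cw] : canc ((\prod_(i | P i) y i) ^+ M).
  have cw : canc (\prod_(i | P i) y i) by apply: (big_ind canc).
  by elim: M {h1} => [|k IH]; [rewrite expr0 | rewrite exprS; exact: cancM].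
by apply: cw => //; exists N.
Qed.

End FactorialSubrings.

(** * From rectangular exchange matrices to generic seeds *)

Section Bridge.
Variables (K : idomainType) (m n : nat) (hnm : (n <= m)%N).
Local Notation FF := (F K m).

Definition Kmor : {rmorphism K -> FF} := (@tofrac _) \o (@mpolyC m K).

Definition Bfun (B : 'M[int]_(m, n)) : 'I_m -> 'I_m -> int := fun i j => Bnat B i j.

Let wd : 'I_n -> 'I_m := widen_ord hnm.

Lemma BnatE (B : 'M[int]_(m, n)) (i : 'I_m) (j : 'I_n) : Bnat B i j = B i j.
Proof. by rewrite /Bnat !valK. Qed.

Lemma Bnat_out (B : 'M[int]_(m, n)) (i j : nat) : (n <= j)%N -> Bnat B i j = 0.
Proof.
by move=> h; rewrite /Bnat [insub j]insubN -?leqNgt //; case: insub.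
Qed.

Lemma gmut_mutate (x : 'I_m -> FF) (B : 'M[int]_(m, n)) (k : 'I_n) :
  gmut (x, Bfun B) (wd k) = ((mutate k (x, B)).1, Bfun (mutate k (x, B)).2).
Proof.
congr (_, _).
  apply: functional_extensionality => s; rewrite /gmutx /= /mutx -[s == wd k]/(val s == val k).
  case: eqP => // _; congr (_ * (_ + _)); apply: eq_big => i; rewrite /Bfun /= BnatE //.
apply: functional_extensionality => i; apply: functional_extensionality => j.
rewrite /Bfun /gmutB /=; have [jn|jn] := ltnP j n; last first.
  by rewrite !(Bnat_out _ _ jn) !(normr0, mulr0, addr0, div0z, oppr0) if_same.
have BE (C : 'M[int]_(m, n)) : Bnat C i j = C i (Ordinal jn) := BnatE C i (Ordinal jn).
by rewrite !BE mxE.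
Qed.

Lemma foldl_mutate (S : ('I_m -> FF) * 'M[int]_(m, n)) (ks : seq 'I_n) :
  gpath (S.1, Bfun S.2) (map wd ks) =
  ((foldl (fun S k => mutate k S) S ks).1, Bfun (foldl (fun S k => mutate k S) S ks).2).
Proof.
elim: ks S => //= k ks IH [x B]; rewrite -/(gpath _ _).
by have := gmut_mutate x B k => /= ->; rewrite -(IH (mutate k (x, B))).
Qed.

Lemma all_wd (ks : seq 'I_n) : all (fun i : 'I_m => (i < n)%N) (map wd ks).
Proof. by rewrite all_map; apply/allP => k _ /=. Qed.

Lemma cluster_gpath x B y : @is_cluster K m n x B y ->
  exists2 ks, all (fun i : 'I_m => (i < n)%N) ks & y = (gpath (x, Bfun B) ks).1.
Proof.
case=> C [ks e]; exists (map wd ks); first exact: all_wd.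
by have /= -> := foldl_mutate (x, B) ks; rewrite e.
Qed.

(** For m > 1 a mutable vertex [k] has a neighbour [l] in the connected graph. If the edge comes
    from the entry at (k, l), then [l] is mutable and skew-symmetrizability makes the entry at (l,
    k) nonzero as well. *)
Lemma seed_good (x : 'I_m -> FF) B : (1 < m)%N -> is_seed x B ->
  good Kmor (fun i : 'I_m => (i < n)%N) (x, Bfun B).
Proof.
move=> m1 [conn [[d [dp dB]] ai]].
have sk : skewable (fun i : 'I_m => (i < n)%N) (Bfun B).
  exists (fun i => if insub (val i) is Some i' then d i' else 1); split.
    by move=> i hi; rewrite insubT.
  move=> i j hi hj; rewrite !insubT.
  have := dB (Ordinal hi) (Ordinal hj); rewrite !mxE.
  exact.
split=> // k kn.
have [j njk] : exists j : 'I_m, j != k.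
  apply/existsP; rewrite -[X in is_true X]negbK negb_exists; apply/negP => /forallP h.
  have : (#|'I_m| <= 1)%N.
    apply/card_le1_eqP => a b _ _; have := h a; have := h b.
    by rewrite !negbK => /eqP -> /eqP ->.
  by rewrite card_ord leqNgt m1.
have /connectP [[|l ls] /=] := conn k j; first by move=> _ e; rewrite e eqxx in njk.
case/andP=> hkl _ _; case/orP: hkl => hb; last by exists l.
have ln : (l < n)%N by rewrite ltnNge; apply: contraNN hb => /Bnat_out ->.
exists l; apply: contraNneq hb => e.
case: sk => d' [dp' h']; have := h' k l kn ln.
rewrite e mulr0 oppr0 => /eqP; rewrite mulf_eq0 => /orP [|//].
by have := dp' k kn; rewrite lt0r => /andP [/negbTE ->].
Qed.

End Bridge.

Lemma intr_inj_char0 (K : idomainType) :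
  ((forall c : K, c != 0 -> c \is a GRing.unit) /\ [pchar K] =i pred0)
    \/ (exists f : {rmorphism int -> K}, bijective f) ->
  injective (fun z : int => z%:~R : K).
Proof.
case=> [[_ /pcharf0P ch]|[f [g fK _]]] a b e.
  have nat_eq0 (k : nat) : k%:R = 0 :> K -> k = 0%N.
    by move/eqP; rewrite ch => /eqP.
  apply/eqP; rewrite -subr_eq0; apply/eqP.
  have : (a - b)%:~R = 0 :> K by rewrite rmorphB /= e subrr.
  case: (a - b) => k; first by move/nat_eq0 ->.
  by rewrite NegzE mulrNz => /eqP; rewrite oppr_eq0 => /eqP /nat_eq0.
by apply: (can_inj fK); rewrite -[a]intz -[b]intz !rmorph_int e.
Qed.

(** * The cluster algebra inside the Laurent rings of its clusters *)

Section ClusterAlgebra.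
Variables (K : idomainType) (m n p : nat).
Hypothesis intK_inj : injective (fun z : int => z%:~R : K).
Hypotheses (hm : (1 < m)%N) (hpm : (p <= m)%N) (hnp : (n <= p)%N).
Variables (x : 'I_m -> F K m) (B : 'M[int]_(m, n)).
Hypothesis hseed : is_seed x B.
Local Notation FF := (F K m).

Let hnm : (n <= m)%N := leq_trans hnp hpm.
Let mut : pred 'I_m := fun i => (i < n)%N.
Let inv : pred 'I_m := fun i => (i < p)%N.
Let kmor : {rmorphism K -> FF} := Kmor K m.
Let S0 : gseed FF 'I_m := (x, Bfun B).
Let mut_inv i : mut i -> inv i. Proof. by move=> h; exact: leq_trans h hnp. Qed.
Let gS : good kmor mut S0. Proof. exact: seed_good. Qed.
Let nv : nonvanishing mut S0. Proof. exact: (good_nonvanishing intK_inj gS). Qed.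
Let sk : skewable mut S0.2. Proof. by case: gS. Qed.
Let A := clalg p x B.

Lemma Kalg_subring (V : FF -> Prop) : Ksubalg V -> subring_pred V.
Proof.
case=> [Vc [VD [VN VM]]]; split=> //.
by have := Vc 1; rewrite /Kemb mpolyC1 tofrac1.
Qed.

Lemma gen_sub (G V : FF -> Prop) f : subring_pred V -> (forall c, V (Kemb m c)) ->
  (forall f, G f -> V f) -> gen G f -> V f.
Proof.
move=> hV Vc VG; elim=> // [a b _ Va _ Vb|a _ Va|a b _ Va _ Vb].
- exact: srD.
- exact: srN.
- exact: srM.
Qed.

(** Returning first to the initial seed connects the seed at the end of [js] to any other one, so
    the Laurent phenomenon applies with that seed as the start. *)
Lemma clalg_klaurent js f : all mut js -> A f -> klaurent kmor inv (gpath S0 js).1 f.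
Proof.
move=> mjs; have hk := klaurent_subring kmor inv (gpath S0 js).1.
apply: gen_sub => // {f} [c|f]; first exact: (klaurent_const kmor).
have fr (i : 'I_m) : (n <= i)%N -> x i = (gpath S0 js).1 i.
  by move=> hi; rewrite (@gpath_frozen _ mut) // /mut -leqNgt.
case=> [[i [/andP [hi ip] [->|->]]]|[[i [hi ->]]|[w [/(cluster_gpath hnm) [ks mks ->] [i [hi ->]]]]]].
- by rewrite fr //; apply: klaurent_var.
- by rewrite fr //; apply: klaurent_inv.
- by rewrite fr ?(leq_trans hnp) //; apply: klaurent_var.
have -> : gpath (x, Bfun B) ks = gpath (gpath S0 js) (rev js ++ ks).
  by rewrite {2}/gpath foldl_cat -/(gpath _ _) -/(gpath _ _) (gpath_rev mjs sk nv).
apply: (laurent_klaurent intK_inj) mut_inv _; first exact: (good_gpath intK_inj).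
by rewrite all_cat all_rev mjs.
Qed.

Lemma klaurent_laurent y f : klaurent kmor inv y f -> laurent p y f.
Proof.
elim=> {f} [f [[c ->]|[[i ->]|[i [ip ->]]]]||a b _ ha _ hb|a _ ha|a b _ ha _ hb].
- exact: gen_K.
- by apply: gen_base; exists i; have [ip|ip] := ltnP i p; [left | right]; auto.
- by apply: gen_base; exists i; left; auto.
- by have := @gen_K K m (fun f => exists i : 'I_m,
        ((i < p)%N /\ (f = y i \/ f = (y i)^-1)) \/ ((p <= i)%N /\ f = y i)) 1; rewrite /Kemb mpolyC1 tofrac1.
- exact: gen_add.
- exact: gen_opp.
- exact: gen_mul.
Qed.

Section Subalgebra.
Variable V : FF -> Prop.
Hypotheses (hV : Ksubalg V) (VA : forall f, V f -> A f).
Hypotheses (Vx1 : forall i : 'I_m, (n <= i < p)%N -> V (x i) /\ V (x i)^-1).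
Hypothesis (Vx2 : forall i : 'I_m, (p <= i)%N -> V (x i)).

Let sV : subring_pred V := Kalg_subring hV.

(** Frozen variables and their permitted inverses lie in [V], so only inverses of mutable variables
    have to be cleared. *)
Lemma laurent_clear_mutable ks f : all mut ks ->
  (forall i : 'I_m, (i < n)%N -> V ((gpath S0 ks).1 i)) -> laurent p (gpath S0 ks).1 f ->
  exists N : nat, V (f * (\prod_(i | mut i) (gpath S0 ks).1 i) ^+ N).
Proof.
move=> mks Vy hf; set w := \prod_(i | mut i) _.
have Vw : V w by apply: sr_prod.
pose G (g : FF) := (exists c, g = Kemb m c) \/ exists i : 'I_m,
  ((i < p)%N /\ (g = (gpath S0 ks).1 i \/ g = ((gpath S0 ks).1 i)^-1)) \/
  ((p <= i)%N /\ g = (gpath S0 ks).1 i).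
have : rgen G f.
  apply: (gen_sub _ _ _ hf) => [|c|g hg]; first exact: rgen_subring.
    by apply: rgen_base; left; exists c.
  by apply: rgen_base; right.
move: f {hf}; apply: (rgen_clear_denom sV Vw).
move=> g [[c ->]|[i hi]]; first by exists 0%N; rewrite mulr1; case: hV.
have [mi|mi] := boolP (mut i).
  have [->|->] : g = (gpath S0 ks).1 i \/ g = ((gpath S0 ks).1 i)^-1.
    by case: hi => [[]|[_]]; auto.
    by exists 0%N; rewrite mulr1; apply: Vy.
  exists 1%N; rewrite expr1 /w (bigD1 i) //= mulKf; last exact: nv.
  by apply: sr_prod => // j /andP [mj _]; apply: Vy.
have ni : (n <= i)%N by rewrite leqNgt.
move: hi; rewrite (@gpath_frozen _ mut) // => hi; exists 0%N; rewrite mulr1.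
case: hi => [[ip]|[ip ->]]; last exact: Vx2.
by have [] := Vx1 (i := i); [rewrite ni | move=> h1 h2 [] ->].
Qed.

Let unit_in_V js u : all mut js -> u != 0 -> frozen_unit kmor mut inv (gpath S0 js).1 u -> unitIn V u.
Proof.
move=> mjs nu fu; have [||h1 h2] := frozen_unit_in sV _ _ fu.
- by case: hV.
- move=> i /andP [mi ii]; rewrite (@gpath_frozen _ mut) //.
  by apply: Vx1; rewrite leqNgt mi.
by split=> //; exists u^-1; rewrite mulfV.
Qed.

(** Factors in [V] are factors in the cluster algebra, so one of them is a scalar unit times a
    frozen Laurent monomial; its inverse lies in [V] too. *)
Lemma cluster_var_irred ks k : all mut ks -> mut k -> V ((gpath S0 ks).1 k) ->
  irredIn V ((gpath S0 ks).1 k).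
Proof.
move=> mks mk Vk; have gk := good_gpath intK_inj mks gS.
have A0 f : A f -> klaurent kmor inv (gpath S0 ks).1 f by apply: clalg_klaurent.
have A1 l f : mut l -> A f -> klaurent kmor inv (gmut (gpath S0 ks) l).1 f.
  move=> ml; have -> : gmut (gpath S0 ks) l = gpath S0 (rcons ks l) by rewrite /gpath foldl_rcons.
  by apply: clalg_klaurent; rewrite all_rcons ml.
have nk : (gpath S0 ks).1 k != 0 by exact: nv.
split=> //; split; first exact/eqP.
split.
  case=> _ [v [Vv e]].
  exact: (var_not_unit intK_inj gk A0 A1 mk (VA Vk) (VA Vv) e).
move=> b c Vb Vc e.
have /andP [nb nc] : (b != 0) && (c != 0) by rewrite -negb_or -mulf_eq0 -e.
case: (var_irreducible intK_inj gk A0 A1 mk (VA Vb) (VA Vc) e) => fu; [left|right].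
  exact: (unit_in_V mks nb fu).
exact: (unit_in_V mks nc fu).
Qed.

(** Both variables are irreducible, so the quotient is a unit, and associated cluster variables
    coincide. *)
Lemma dvd_cluster_var_eq ks1 ks2 i j : all mut ks1 -> all mut ks2 -> mut i -> mut j ->
  V ((gpath S0 ks1).1 i) -> V ((gpath S0 ks2).1 j) ->
  dvdIn V ((gpath S0 ks1).1 i) ((gpath S0 ks2).1 j) ->
  (gpath S0 ks1).1 i = (gpath S0 ks2).1 j.
Proof.
move=> m1 m2 mi mj Vi Vj [c [Vc e]].
have [_ [_ [nu _]]] := cluster_var_irred m1 mi Vi.
have [_ [_ [_ irr]]] := cluster_var_irred m2 mj Vj.
case: (irr _ _ Vi Vc e) => // -[_ [c' [Vc' cc]]].
have fu : frozen_unit kmor mut inv S0.1 c.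
  apply: (unit_frozen intK_inj gS (A := A) _ _ (VA Vc) (VA Vc') cc).
    by move=> f; apply: (clalg_klaurent (js := [::])).
  by move=> k f mk; apply: (clalg_klaurent (js := [:: k])); rewrite /= mk.
apply: esym; apply: (assoc_var_eq intK_inj mut_inv gS m2 m1 mj mi fu).
by rewrite mulrC.
Qed.

End Subalgebra.
End ClusterAlgebra.

(** * The inclusions between U, the cluster algebra and U(y,z) *)

Theorem theorem1p4 (K : idomainType) (m n p : nat)
  (hK : ((forall c : K, c != 0 -> c \is a GRing.unit) /\ [pchar K] =i pred0)
        \/ (exists f : {rmorphism int -> K}, bijective f))
  (hm : (1 < m)%N) (hpm : (p <= m)%N) (hnp : (n <= p)%N) (hn : (1 <= n)%N)
  (x : 'I_m -> F K m) (B : 'M[int]_(m, n)) (hseed : is_seed x B)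
  (y z : 'I_m -> F K m) (hy : is_cluster x B y) (hz : is_cluster x B z)
  (hyz : disjoint_clusters n y z)
  (U : F K m -> Prop) (hU : Ksubalg U) (hUA : forall f, U f -> clalg p x B f)
  (hUfact : is_factorial U)
  (hUy : forall i : 'I_m, (i < n)%N -> U (y i))
  (hUz : forall i : 'I_m, (i < n)%N -> U (z i))
  (hUx1 : forall i : 'I_m, (n <= i < p)%N -> U (x i) /\ U (x i)^-1)
  (hUx2 : forall i : 'I_m, (p <= i)%N -> U (x i)) :
  (forall f, U f <-> clalg p x B f) /\
  (forall f, clalg p x B f <-> Uyz p y z f) /\
  is_factorial (clalg p x B) /\
  (forall f, is_cluster_var x B f -> primeIn (clalg p x B) f).
Proof.
have intK := intr_inj_char0 hK; have hnm := leq_trans hnp hpm.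
have sU := Kalg_subring hU.
have [k1 m1 ey] := cluster_gpath hnm hy; have [k2 m2 ez] := cluster_gpath hnm hz.
have irr ks (k : 'I_m) : all (fun i : 'I_m => (i < n)%N) ks -> (k < n)%N ->
    U ((gpath (x, Bfun B) ks).1 k) -> irredIn U ((gpath (x, Bfun B) ks).1 k).
  exact: (cluster_var_irred intK hm hpm hnp hseed).
have AL f : clalg p x B f -> Uyz p y z f.
  move=> Af; split; [rewrite ey|rewrite ez];
    by apply: klaurent_laurent; apply: (clalg_klaurent intK hm hpm hnp hseed).
(* Both expansions clear into [U], one by a power of the product of the y_i, the other by a power of
   the product of the z_j. The y_i are primes of [U], and one dividing some z_j would equal it,
   against disjointness. *)
have LU f : Uyz p y z f -> U f.
  subst y z; case=> fy fz.
  have [N1 h1] := laurent_clear_mutable intK hm hseed hU hUx1 hUx2 m1 hUy fy.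
  have [N2 h2] := laurent_clear_mutable intK hm hseed hU hUx1 hUx2 m2 hUz fz.
  apply: (cancel_primes sU _ hUz _ h1 h2) => [i hi|i j hi hj dv].
    by apply: factorial_irred_prime => //; apply: irr => //; apply: hUy.
  apply: (hyz i j hi hj); move: dv.
  apply: (dvd_cluster_var_eq intK hm hpm hnp hseed hU hUA hUx1 m1 m2 hi hj (hUy i hi) (hUz j hj)).
have UA f : U f <-> clalg p x B f by split; [exact: hUA | move/AL/LU].
have eUA : clalg p x B = U.
  by apply: functional_extensionality => f; apply: propositional_extensionality; split=> /UA.
split; [|split; [|split]] => //.
- by move=> f; split; [exact: AL | move/LU/hUA].
- by rewrite eUA.
move=> f cv; rewrite eUA; have Uf : U f by apply/UA; apply: gen_base; right; right.
case: cv Uf => w [/(cluster_gpath hnm) [ks mks ->] [i [hi ->]]] Uf.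
by apply: factorial_irred_prime => //; apply: irr.
Qed.
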